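(* Let $A$ be a Banach algebra with a bounded approximate identity and an $F\ell^1(\eta)$-base (of type 1, 2 or 3) for some infinite cardinal $\eta$ and some $m\in\mathbb N$ ($m=1$ for types 1 and 2), and let $X_1,\dots,X_m\subseteq LUC(A)^*$ be the associated sets $X_k=\{\Psi_{pk}:p\in\mathscr C(\eta)\}$. Then $A^*$ has the uniform $\eta$-factorization property through $\prod_{k=1}^mX_k$. That is, each $X_k$ has cardinality at least $\eta$, and for every bounded family $\{S_\lambda:\lambda<\eta\}$ in $A^*$ there exist a bounded family $\{(\Psi_{\lambda k})_{k=1}^m:\lambda<\eta\}$ in $\prod_{k=1}^mX_k$ and functionals $T_1,\dots,T_m\in A^*$ with $$S_\lambda=\sum_{k=1}^m\Psi_{\lambda k}\cdot T_k\qquad\text{for all }\lambda<\eta,$$ where moreover the elements $(\Psi_{\lambda k})_{k=1}^m$, $\lambda<\eta$, can be chosen in $\prod_{k=1}^mX_k$ independently of the family $\{S_\lambda:\lambda<\eta\}$.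
   Context: Module actions. $\langle S\cdot a,b\rangle=\langle S,ab\rangle$ for $S\in A^*$, $a,b\in A$. $LUC(A)$ is the closed linear span of $\{S\cdot a:S\in A^*,a\in A\}$ in $A^*$. $LUC(A)^*$ acts on $A^*$ by $\langle\Psi\cdot S,a\rangle=\langle\Psi,S\cdot a\rangle$. Right multipliers. $M_r(A)$ is the algebra of bounded operators $R$ on $A$ with $R(ab)=aR(b)$, with product $R_1R_2=R_2\circ R_1$; $A$ sits in $M_r(A)$ by right multiplications, and $aR=R(a)\in A$ for $a\in A$, $R\in M_r(A)$. When $A$ has a bounded approximate identity (bai) $(e_i)$, $R\in M_r(A)$ is viewed in $LUC(A)^*$ as the weak$^*$-limit of $(R(e_i))$, i.e. $\langle R,S\cdot a\rangle=\langle S,aR\rangle$. $\langle E\rangle$ denotes linear span; cardinals are identified with initial ordinals. $\ell^1(\eta)$-base with constant $K>0$: a bounded set $\{x_\alpha:\alpha<\eta\}$ in a normed space such that $\sum_{n=1}^p|z_n|\le K\|\sum_{n=1}^pz_nx_{\alpha_n}\|$ for all $p\in\mathbb N$, all scalars $z_1,\dots,z_p$ and all distinct elements $x_{\alpha_1},\dots,x_{\alpha_p}$ of the set. $\ell^1(\eta)$-selective base with constant $K_1>0$: a bounded set $\mathscr L=\bigcup_{\alpha<\eta}\mathscr L_\alpha$ with each $\mathscr L_\alpha$ nonempty, such that the spans $\langle\mathscr L_\alpha\rangle$ have zero pairwise intersections and $\sum_{n=1}^p\|x_n\|\le K_1\|\sum_{n=1}^px_n\|$ whenever $x_n\in\langle\mathscr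 L_{\alpha_n}\rangle$ for $n=1,\dots,p$, with $\alpha_1,\dots,\alpha_p$ distinct. Zooming set in $A$ (with a bai): a set $\mathscr L=\bigcup_{\alpha<\eta}A_\alpha a_\alpha$ where (i) $\{A_\alpha\}_{\alpha<\eta}$ is an increasing family of subsets of $A$ such that $A_\eta=\bigcup_{\alpha<\eta}A_\alpha$ is bounded (one may assume the bound is $1$) and has closed linear span $A$; (ii) $\{a_\alpha:\alpha<\eta\}$ is a bounded subset of $M_r(A)$; (iii) the spans $\langle A_\alpha a_\alpha\rangle$, $\alpha<\eta$, have zero pairwise intersections. $F\ell^1(\eta)$-base of type 1: a zooming set that is an $\ell^1(\eta)$-base. Type 2: a zooming set $\bigcup_{\alpha<\eta} A_\alpha a_\alpha$ that is an $\ell^1(\eta)$-selective base (with $\mathscr L_\alpha=A_\alpha a_\alpha$) such that for some $K_2>0$, $\|a\|\le K_2\|aa_\alpha\|$ for all $a\in\langle A_\alpha\rangle$, $\alpha<\eta$. Type 3: a zooming $\ell^1(\eta)$-selective base of the form $\mathscr L=\bigcup_{\alpha<\eta}A_\alpha\{a_\alpha^k:k=1,\dots,m\}$ (with $\mathscr L_\alpha=\bigcup_{k=1}^mA_\alpha a_\alpha^k$), where $\{A_\alpha\}$ is as in (i), $\{\mathbf a_\alpha=(a_\alpha^k)_{k=1}^m:\alpha<\eta\}$ is bounded in $M_r(A)^m$, condition (iii) means that for each $k$ the spans $\langle A_\alpha\rangle a_\alpha^k$, $\alpha<\eta$, have zero pairwise intersections, and for some $K_2>0$, $\|a\|\le K_2\|a\mathbf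 a_\alpha\|$ for all $a\in\langle A_\alpha\rangle$, $\alpha<\eta$, where $a\mathbf a_\alpha=(aa_\alpha^k)_{k=1}^m\in A^m$ and $\|a\mathbf a_\alpha\|$ is any of the $p$-norms, $p=1,2,\dots,\infty$. For types 1 and 2 put $m=1$ and $a_\alpha^1=a_\alpha$. Cluster points. $\mathscr C(\eta)$ is the set of cofinal ultrafilters on $\eta$ (all members cofinal in $\eta$). For $p\in\mathscr C(\eta)$ and $k\le m$, $\Psi_{pk}\in LUC(A)^*$ is the value at $p$ of the continuous extension to $\beta\eta$ ($\eta$ discrete) of the bounded map $\alpha\mapsto a_\alpha^k\in M_r(A)\subseteq LUC(A)^*$ (weak$^*$ topology), i.e. the weak$^*$-limit of $a_\alpha^k$ along $p$.
   Formalization: A is nonzero; in type 1 each map x ↦ x a_α is injective on A_α; for m ≥ 2, |X_k| ≥ η is claimed for some k and for each k where some x has ‖x a_α^k‖ bounded below for all large α, as it fails for every k (e.g. a_α^2 = 0). *)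

(* Defs.v *)
From HB Require Import structures.
From mathcomp Require Import all_boot all_order all_algebra.
From mathcomp Require Import complex.
From mathcomp Require Import all_classical all_reals all_analysis.

Set Implicit Arguments.
Unset Strict Implicit.
Unset Printing Implicit Defensive.

Import Order.TTheory GRing.Theory Num.Theory.
Import numFieldNormedType.Exports.

Local Open Scope classical_set_scope.
Local Open Scope ring_scope.

Variant real_or_complex : numFieldType -> Prop :=
| RealScalars (R : realType) : real_or_complex R
| ComplexScalars (R : realType) : real_or_complex R[i].

(* MathComp rings are unital, Banach algebras are not: the product is a
   separate operation [bmul] on a Banach space. *)
HB.mixin Record isBanachAlgebra (K : numFieldType) A
    of CompleteNormedModule K A := {
  bmul : A -> A -> A ;
  bmulA : associative bmul ;
  bmul_linearl : forall b : A, linear (bmul ^~ b) ;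
  bmul_linearr : forall a : A, linear (bmul a) ;
  ler_norm_bmul : forall a b : A, `|bmul a b| <= `|a| * `|b|
}.

#[short(type="banachAlgType")]
HB.structure Definition BanachAlgebra (K : numFieldType) :=
  {A of CompleteNormedModule K A & isBanachAlgebra K A}.

Section Span.
Context {K : numFieldType} {V : lmodType K}.

Definition lspan (E : set V) : set V :=
  [set v | exists n (c : 'I_n -> K) (x : 'I_n -> V),
      (forall i, E (x i)) /\ v = \sum_i c i *: x i].

Definition zero_intersections {I : Type} (E : I -> set V) : Prop :=
  forall i j, i <> j -> lspan (E i) `&` lspan (E j) = [set 0].

Lemma sub_lspan (E : set V) : E `<=` lspan E.
Proof.
by move=> v Ev; exists 1%N, (fun=> 1), (fun=> v); rewrite big_ord1 scale1r.
Qed.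

Lemma lspan_submod (E : set V) :
  lspan E 0 /\ forall c u v, lspan E u -> lspan E v -> lspan E (c *: u + v).
Proof.
split=> [|a _ _ [n [c [x [Ex ->]]]] [p [d [y [Ey ->]]]]].
  by exists 0%N, (fun=> 0), (fun=> 0); rewrite big_ord0; split => // -[].
exists (n + p)%N,
  (fun i : 'I_(n + p) => match fintype.split i with inl j => a * c j | inr j => d j end),
  (fun i : 'I_(n + p) => match fintype.split i with inl j => x j | inr j => y j end).
split=> [i|]; first by case: (fintype.split i).
rewrite big_split_ord scaler_sumr; congr (_ + _); apply: eq_bigr => i _.
  by rewrite (unsplitK (inl i)) scalerA.
by rewrite (unsplitK (inr i)).
Qed.

End Span.

(* ||f|| <= M for the operator norm. *)
Definition opnorm_le {K : numFieldType} {U V : normedModType K}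
  (f : U -> V) (M : K) : Prop := 0 <= M /\ forall x, `|f x| <= M * `|x|.

Lemma continuous_opnorm_le {K : numFieldType} {U V : normedModType K}
  (f : {linear U -> V}) : continuous f <-> exists M, opnorm_le f M.
Proof.
split=> [/linear_bounded_continuous/linear_boundedP/pinfty_ex_gt0[M M0 Mf]|].
  by exists M; split; [exact: ltW|].
move=> [M [M0 Mf]]; apply/linear_bounded_continuous/linear_boundedP.
exists M; split; first exact: ger0_real.
by move=> r Mr x; rewrite (le_trans (Mf x))// ler_wpM2r// ltW.
Qed.

Section Dual.
Context {K : numFieldType} (U : normedModType K).

Definition dual_pred : {pred U -> K^o} :=
  fun f => `[< linear f /\ continuous f >].

Record dual := Dual { dual_fun :> U -> K^o ; _ : dual_fun \in dual_pred }.

Fact dual_submod_closed : submod_closed dual_pred.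
Proof.
split=> [|c f g /asboolP[lf cf] /asboolP[lg cg]]; apply/asboolP; split.
- by move=> a x y /=; rewrite scaler0 addr0.
- exact: cst_continuous.
- move=> a x y; rewrite !fctE lf lg !scalerDr !scalerA addrACA.
  by rewrite (mulrC c).
- move=> x; apply: (@continuousD K K^o U (c *: f) g); last exact: cg.
  by apply: (@continuousZl_tmp K K^o U f c); exact: cf.
Qed.

HB.instance Definition _ :=
  GRing.isSubmodClosed.Build K (U -> K^o) dual_pred dual_submod_closed.

HB.instance Definition _ := [isSub for dual_fun].
HB.instance Definition _ := [Choice of dual by <:].
HB.instance Definition _ := [SubChoice_isSubLmodule of dual by <:].

Lemma in_dual_pred (f : U -> K^o) :
  f \in dual_pred <-> linear f /\ exists M, opnorm_le f M.
Proof.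
split=> [/asboolP[lf cf]|[lf bf]]; [split=> //|apply/asboolP; split=> //].
  pose g : {linear U -> K^o} := HB.pack f (GRing.isLinear.Build _ _ _ _ f lf).
  exact: (continuous_opnorm_le g).1.
pose g : {linear U -> K^o} := HB.pack f (GRing.isLinear.Build _ _ _ _ f lf).
exact: (continuous_opnorm_le g).2.
Qed.

End Dual.
Arguments dual_pred {K} U.

Section LUC.
Context {K : numFieldType} {A : banachAlgType K}.
Implicit Types (S T : dual A) (a b : A).

Fact dual_mul_subproof S a : (fun b => S (bmul a b)) \in dual_pred A.
Proof.
case: S => S /= /in_dual_pred[lS [M [M0 SM]]]; apply/in_dual_pred; split.
  by move=> c x y; rewrite bmul_linearr lS.
exists (M * `|a|); split=> [|x]; first by rewrite mulr_ge0.
by rewrite (le_trans (SM _))// -mulrA ler_wpM2l// ler_norm_bmul.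
Qed.

(* [dual_mul S a] is the functional S . a. *)
Definition dual_mul S a : dual A := Dual (dual_mul_subproof S a).

(* Membership in the norm closure of the span of all S . a. *)
Definition luc_pred : {pred dual A} := fun F =>
  `[< forall eps : K, 0 < eps ->
      exists2 G, lspan [set dual_mul S a | S in setT & a in setT] G &
        opnorm_le (F - G : dual A) eps >].

Record luc := LUC { luc_val :> dual A ; _ : luc_val \in luc_pred }.

Fact luc_submod_closed : submod_closed luc_pred.
Proof.
split=> [|c F F' /asboolP hF /asboolP hF']; apply/asboolP => eps eps0.
  exists 0; first exact: (lspan_submod _).1.
  by rewrite subrr; split=> [|x]; [exact: ltW|rewrite /= normr0 mulr_ge0// ltW].
have c1 : 0 < `|c| + 1 by rewrite ltr_wpDl.
have [|G EG [_ FG]] := hF (eps / 2 / (`|c| + 1)); first by rewrite !divr_gt0.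
have [|G' EG' [_ FG']] := hF' (eps / 2); first by rewrite divr_gt0.
exists (c *: G + G'); first exact: (lspan_submod _).2.
split=> [|x]; first exact: ltW.
have -> : (c *: F + F' - (c *: G + G') : dual A) x =
    c *: (F - G : dual A) x + (F' - G' : dual A) x.
  suff -> : c *: F + F' - (c *: G + G') = c *: (F - G) + (F' - G') by [].
  by rewrite opprD addrACA scalerBr.
rewrite (le_trans (ler_normD _ _))// [in leRHS](splitr eps) mulrDl lerD//.
rewrite normrZ (le_trans (ler_wpM2l _ (FG _)))// mulrA ler_wpM2r//.
rewrite mulrCA ger_pMr ?divr_gt0// ler_pdivrMr// mul1r.
by rewrite lerDl.
Qed.

HB.instance Definition _ :=
  GRing.isSubmodClosed.Build K (dual A) luc_pred luc_submod_closed.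

HB.instance Definition _ := [isSub for luc_val].
HB.instance Definition _ := [Choice of luc by <:].
HB.instance Definition _ := [SubChoice_isSubLmodule of luc by <:].

Fact dual_mul_luc S a : dual_mul S a \in luc_pred.
Proof.
apply/asboolP => eps eps0; exists (dual_mul S a).
  by apply: sub_lspan; exists S => //; exists a.
by rewrite subrr; split=> [|x]; [exact: ltW|rewrite /= normr0 mulr_ge0// ltW].
Qed.

Definition luc_mul S a : luc := LUC (dual_mul_luc S a).

(* ||Psi|| <= C for the norm of LUC(A)^*, LUC(A) being normed as a subspace
   of A^*. *)
Definition lucdual_norm_le (Psi : luc -> K^o) (C : K) : Prop :=
  0 <= C /\ forall (F : luc) M, opnorm_le F M -> `|Psi F| <= C * M.

Record lucdual := LUCDual {
  lucdual_fun :> luc -> K^o ;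
  lucdual_linear : linear lucdual_fun ;
  lucdual_bounded : exists C, lucdual_norm_le lucdual_fun C }.

Fact lucdual_act_subproof (Psi : lucdual) T :
  (fun a => Psi (luc_mul T a)) \in dual_pred A.
Proof.
case: Psi => Psi /= lPsi [C [C0 PsiC]].
have [lT [M [M0 TM]]] : linear T /\ exists M, opnorm_le T M.
  by apply/in_dual_pred; exact: valP T.
apply/in_dual_pred; split=> [c a b|].
  rewrite -lPsi; congr Psi.
  by apply/val_inj/val_inj/funext => x /=; rewrite bmul_linearl lT.
exists (C * M); split=> [|a]; first by rewrite mulr_ge0.
rewrite -mulrA; apply: PsiC; split=> [|x]; first by rewrite mulr_ge0.
by rewrite (le_trans (TM _))// -mulrA ler_wpM2l// ler_norm_bmul.
Qed.

(* [lucdual_act Psi T] is the functional Psi . T. *)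
Definition lucdual_act (Psi : lucdual) T : dual A :=
  Dual (lucdual_act_subproof Psi T).

Definition weakstar_cvg (T : Type) (E : set_system T) (Psi_ : T -> lucdual)
    (Psi : lucdual) : Prop :=
  forall F : luc, Psi_ t F @[t --> E] --> Psi F.

End LUC.
Arguments luc {K} A.
Arguments luc_pred {K} A.
Arguments lucdual {K} A.

Section Multipliers.
Context {K : numFieldType} {A : banachAlgType K}.

Record rmultiplier := RMultiplier {
  rmult_fun :> {linear A -> A} ;
  rmult_continuous : continuous rmult_fun ;
  rmult_mul : forall a b, rmult_fun (bmul a b) = bmul a (rmult_fun b) }.

Definition tails {d} (D : preorderType d) : set_system D :=
  [set B | exists i, forall j, (i <= j)%O -> B j].
Arguments tails {d} D.

Definition bounded_approximate_identity {d} {D : preorderType d}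
    (e : D -> A) : Prop :=
  [/\ [set: D] !=set0,
      forall i j : D, exists k, (i <= k)%O /\ (j <= k)%O,
      bounded_set (range e) &
      forall a, bmul a (e i) @[i --> tails D] --> a /\
                bmul (e i) a @[i --> tails D] --> a].

(* [Phi] is [R], viewed in LUC(A)^* as the weak* limit of the net (R(e_i)). *)
Definition is_rmult_image {d} {D : preorderType d} (e : D -> A)
    (R : rmultiplier) (Phi : lucdual A) : Prop :=
  forall F : luc A, F (R (e i)) @[i --> tails D] --> Phi F.

End Multipliers.
Arguments rmultiplier {K} A.

(* A cardinal is identified with an initial ordinal, that is a well-order all
   of whose proper initial segments have strictly smaller cardinality. *)
Definition initial_ordinal {d} (eta : orderType d) : Prop :=
  well_founded (fun i j : eta => (i < j)%O) /\
  forall i : eta, ~~ ([set: eta] #<= [set j : eta | (j < i)%O])%card.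

Section Bases.
Context {K : numFieldType} {A : banachAlgType K} {d} {eta : orderType d}.
Implicit Types (As : eta -> set A).

Definition l1_base (L : set A) : Prop :=
  [/\ exists x : eta -> A, L = range x,
      bounded_set L &
      exists2 C : K, 0 < C &
        forall p (z : 'I_p -> K) (x : 'I_p -> A),
          injective x -> (forall n, L (x n)) ->
          \sum_n `|z n| <= C * `|\sum_n z n *: x n|].

Definition l1_selective_base (Ls : eta -> set A) : Prop :=
  [/\ bounded_set (\bigcup_i Ls i),
      forall i, Ls i !=set0,
      zero_intersections Ls &
      exists2 C : K, 0 < C &
        forall p (alpha : 'I_p -> eta) (x : 'I_p -> A),
          injective alpha -> (forall n, lspan (Ls (alpha n)) (x n)) ->
          \sum_n `|x n| <= C * `|\sum_n x n|].

(* The case m = 1 is a zooming set; m > 1 only occurs in type 3. *)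
Definition zooming {m} As (a : eta -> 'I_m -> rmultiplier A) : Prop :=
  [/\ forall i j, (i <= j)%O -> As i `<=` As j,
      bounded_set (\bigcup_i As i),
      closure (lspan (\bigcup_i As i)) = setT,
      exists M, forall i k, opnorm_le (a i k) M &
      forall k, zero_intersections (fun i => a i k @` As i)].

(* The clause [{in As i &, injective (a i)}] makes explicit that the l^1-base is
   indexed by the pairs (alpha, x) with x in A_alpha: coincidences
   x a_alpha = y a_alpha with x <> y are excluded.  Otherwise, if A has a
   character phi and x a_alpha = phi(x) u_alpha for an l^1-base (u_alpha), one
   could take phi = 1 on all A_alpha, and Psi . T would always be a multiple
   of phi. *)
Definition Fl1_base1 As (a : eta -> rmultiplier A) : Prop :=
  [/\ zooming As (fun i (_ : 'I_1) => a i),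
      l1_base (\bigcup_i (a i @` As i)) &
      forall i, {in As i &, injective (a i)}].

Definition Fl1_base2 As (a : eta -> rmultiplier A) : Prop :=
  [/\ zooming As (fun i (_ : 'I_1) => a i),
      l1_selective_base (fun i => a i @` As i) &
      exists2 C : K, 0 < C &
        forall i x, lspan (As i) x -> `|x| <= C * `|a i x|].

(* c <= ||v||_p for c >= 0, where [None] stands for p = oo and [Some q] for
   p = q + 1. *)
Definition le_pnorm {m} (p : option nat) (c : K) (v : 'I_m -> A) : Prop :=
  match p with
  | Some q => c ^+ q.+1 <= \sum_k `|v k| ^+ q.+1
  | None => exists k, c <= `|v k|
  end.

Definition Fl1_base3 {m} As (a : eta -> 'I_m -> rmultiplier A) : Prop :=
  [/\ zooming As a,
      l1_selective_base (fun i => \bigcup_k (a i k @` As i)) &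
      exists p, exists2 C : K, 0 < C &
        forall i x, lspan (As i) x -> le_pnorm p `|x| (fun k => C *: a i k x)].

Variant Fl1_base As : forall m, (eta -> 'I_m -> rmultiplier A) -> Prop :=
| Fl1_type1 a of Fl1_base1 As a : Fl1_base As (fun i (_ : 'I_1) => a i)
| Fl1_type2 a of Fl1_base2 As a : Fl1_base As (fun i (_ : 'I_1) => a i)
| Fl1_type3 m (a : eta -> 'I_m -> rmultiplier A) of Fl1_base3 As a :
    Fl1_base As a.

Definition cofinal_ultrafilter (p : set_system eta) : Prop :=
  UltraFilter p /\
  forall B, p B -> forall i, exists2 j, B j & (i <= j)%O.

(* The set X_k of all Psi_{pk}, p in C(eta). *)
Definition cluster_set {d'} {D : preorderType d'} (e : D -> A) {m}
    (a : eta -> 'I_m -> rmultiplier A) (k : 'I_m) : set (lucdual A) :=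
  [set Psi | exists p, cofinal_ultrafilter p /\
    exists Phi : eta -> lucdual A,
      (forall i, is_rmult_image e (a i k) (Phi i)) /\ weakstar_cvg p Phi Psi].

(* For a type 3 base a single coordinate may degenerate: replacing (a_alpha) of
   type 2 by the pairs (a_alpha, 0) gives a type 3 base with X_2 = {0}.  This
   condition on the k-th coordinate rules this out; it always holds for
   types 1 and 2 when A is nonzero. *)
Definition nondegenerate_coord {m} (a : eta -> 'I_m -> rmultiplier A) (k : 'I_m) :
    Prop :=
  exists (x : A) (i0 : eta), exists2 delta : K, 0 < delta &
    forall i, (i0 <= i)%O -> delta <= `|a i k x|.

(* The factorization clause of the uniform eta-factorization property, with
   the tuples [Psi l] chosen before the family [S]. *)
Definition uniform_factorization {m} (X : 'I_m -> set (lucdual A)) : Prop :=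
  exists Psi : eta -> 'I_m -> lucdual A,
    [/\ forall l k, X k (Psi l k),
        exists C, forall l k, lucdual_norm_le (Psi l k) C &
        forall S : eta -> dual A, (exists M, forall l, opnorm_le (S l) M) ->
          exists T : 'I_m -> dual A,
            forall l, S l = \sum_k lucdual_act (Psi l k) (T k)].

End Bases.

(* Main.v *)
Require Import Defs.
From HB Require Import structures.
From mathcomp Require Import all_boot all_order all_algebra.
From mathcomp Require Import complex.
From mathcomp Require Import all_classical all_reals all_analysis.
From mathcomp Require Import ring.

Set Implicit Arguments.
Unset Strict Implicit.
Unset Printing Implicit Defensive.

Import Order.TTheory GRing.Theory Num.Theory.
Import numFieldNormedType.Exports.

Local Open Scope classical_set_scope.
Local Open Scope ring_scope.

(* Fix pairwise disjoint cofinal sets [B_l], [l < eta], cofinal ultrafilters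
   [p_l] containing [B_l], and let [Psi_l k] be the weak* limit of [a_alpha^k]
   along [p_l], so that [(Psi_l k . T)(x) = lim_(alpha -> p_l) T (a_alpha^k x)].
   The l^1-conditions on the base say exactly that the assignment
     [(x a_alpha^k)_k |-> S_l x]    ([x] in [A_alpha], [alpha] in [B_l])
   extends to a bounded functional on the span of these vectors in [A ^ m];
   a Hahn-Banach extension [(T_k)_k] to [A ^ m] then satisfies
   [sum_k T_k (a_alpha^k x) = S_l x] for all large [alpha] in [B_l], and the
   limit along [p_l] gives the factorization on the dense span of the [A_alpha].
   The same interpolation argument separates the functionals [Psi_l k]. *)

(** * The Hahn-Banach theorem over the real and complex numbers *)

(** The prescribed functional is handled through its graph, a subspace of [A ^ m * K]: one estimate
    of the second component by the first gives single-valuedness and boundedness together. The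
    estimate has two sources. In type 1 the coefficients of a combination are controlled, provided
    distinct pairs (alpha, x) give distinct base elements. In types 2 and 3 the norms of the blocks
    are controlled, and the lower bound on x a_alpha turns them into norms of the x themselves.
    Sharp constants never matter, so a Hahn-Banach theorem losing a factor 2 suffices. Each [B_l]
    contains the l-th row of a copy of eta x eta inside eta; a row has full cardinality, and in an
    initial ordinal this forces cofinality. When m = 1, separation follows from the factorization
    itself. When m > 1 it does not, because tuples may differ in one coordinate and agree in
    another. A single vector y then serves as test, its images under the k-th multipliers staying
    away from 0 on an index set of full cardinality; a pigeonhole over the m coordinates provides
    such a k. *)

Section HahnBanach.
Variables (R : realType) (K : nzRingType) (iota : {rmorphism R -> K}).
Variables (V : lmodType K) (p : V -> R).
Hypothesis pD : forall u v, p (u + v) <= p u + p v.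
Hypothesis pZ : forall c v, 0 <= c -> p (iota c *: v) = c * p v.

Let dominated_subspace (H : set (V * R)) :=
  (forall c u v r s, H (u, r) -> H (v, s) -> H (iota c *: u + v, c * r + s)) /\
  (forall v r, H (v, r) -> r <= p v).

(** The classical extension by one vector, with real scalars acting through [iota] so that a complex
    space can be treated as a real one. *)
Let one_step (H : set (V * R)) v0 : dominated_subspace H -> H (0, 0) ->
  exists t, dominated_subspace
    [set w | exists c u r, H (u, r) /\ w = (u + iota c *: v0, r + c * t)].
Proof.
move=> [Hlin Hle] H0.
(* The admissible values [t] at [v0] lie between all r - p (v - v0) and all p (w + v0) - s; [sup E]
   is the least of them. *)
pose E := [set x | exists v r, H (v, r) /\ x = r - p (v - v0)].
have Eub v r w s : H (v, r) -> H (w, s) -> r - p (v - v0) <= p (w + v0) - s.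
  move=> Hv Hw; rewrite lerBlDr addrAC lerBrDr.
  have := Hlin 1 _ _ _ _ Hv Hw; rewrite rmorph1 scale1r mul1r => /Hle/le_trans.
  apply; rewrite (le_trans _ (pD _ _))// le_eqVlt; apply/orP; left; apply/eqP.
  by rewrite addrACA subrr addr0 addrC.
have E0 : E !=set0 by exists (0 - p (0 - v0)), 0, 0.
have supub : has_sup E.
  split=> //; exists (p (0 + v0) - 0) => _ [v [r [Hv ->]]]; exact: Eub.
exists (sup E); split=> [c u v r s|].
  move=> [d [u' [r' [Hu' [-> ->]]]]] [d' [v' [s' [Hv' [-> ->]]]]].
  exists (c * d + d'), (iota c *: u' + v'), (c * r' + s'); split; first exact: Hlin.
  congr pair; last by rewrite mulrDr mulrDl addrACA mulrA.
  by rewrite scalerDr scalerA rmorphD rmorphM scalerDl addrACA.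
move=> v r [c [u [s [Hu [-> ->]]]]].
have scale d : 0 < d -> H (iota d^-1 *: u, d^-1 * s).
  by move=> d0; have := Hlin d^-1 _ _ _ _ Hu H0; rewrite !addr0.
have unscale d w : 0 < d -> p w = d * p (iota d^-1 *: w).
  by move=> d0; rewrite pZ ?invr_ge0 ?ltW// mulrA divff ?mul1r// gt_eqF.
(* Homogeneity reduces to c = -1 or c = 1. The first case uses that [sup E] bounds [E], the second
   that it is the least bound. *)
have [c0|c0|->] := ltgtP c 0; last by rewrite rmorph0 scale0r mul0r !addr0; exact: Hle.
- have d0 : 0 < - c by rewrite oppr_gt0.
  rewrite (unscale _ _ d0) -ler_pdivrMl// scalerDr scalerA -rmorphM mulrDr.
  have -> : (- c)^-1 * c = -1 by rewrite invrN mulNr mulVf// lt_eqF.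
  have -> : (- c)^-1 * (c * sup E) = - sup E by rewrite invrN mulNr mulKf// lt_eqF.
  rewrite rmorphN1 scaleN1r lerBlDr -lerBlDl.
  apply: (sup_upper_bound supub); exists (iota (- c)^-1 *: u), ((- c)^-1 * s).
  by split=> //; exact: scale.
- rewrite (unscale _ _ c0) -ler_pdivrMl// scalerDr scalerA -rmorphM mulrDr.
  rewrite mulVf ?gt_eqF// rmorph1 scale1r mulKf ?gt_eqF// addrC -lerBrDr.
  by apply: ge_sup => // _ [w [r' [Hw ->]]]; apply: Eub => //; exact: scale.
Qed.

(* Linear functionals are handled through their graphs: a subspace of [V * R]
   dominated by [p] is automatically single-valued, since [p 0 = 0]. *)
Lemma hahn_banach_graph (G : set (V * R)) :
    G (0, 0) ->
    (forall c u v r s, G (u, r) -> G (v, s) -> G (iota c *: u + v, c * r + s)) ->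
    (forall v r, G (v, r) -> r <= p v) ->
  exists g : V -> R, [/\ forall c u v, g (iota c *: u + v) = c * g u + g v,
    forall v, g v <= p v & forall v r, G (v, r) -> g v = r].
Proof.
move=> G0 Glin Gle.
(* Adjoining [G] makes the empty set admissible, so the empty chain needs no separate treatment in
   Zorn's lemma. *)
pose P H := dominated_subspace (H `|` G).
have [F FP Ftot|H [PH Hmax]] := @Zorn_bigcup _ P.
  split=> [c u v r s|v r].
    have sub H : H = set0 \/ F H -> H `|` G `<=` \bigcup_(X in F) X `|` G.
      move=> [->|FH] x; first by rewrite set0U; right.
      by case; [left; exists H|right].
    have PH H : H = set0 \/ F H -> P H.
      by move=> [->|/FP//]; rewrite /P set0U; split.
    have mem x : (\bigcup_(X in F) X `|` G) x ->
        exists2 H, H = set0 \/ F H & (H `|` G) x.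
      by move=> [[H FH Hx]|Gx]; [exists H; [right|left]|exists set0; [left|right]].
    move=> /mem[H FH Hu] /mem[H' FH' Hv].
    have [HH'|H'H] : H `<=` H' \/ H' `<=` H.
      move: FH FH' => [-> _|FH [->|FH']]; [left|right|exact: Ftot];
        exact: sub0set.
      - apply: (sub _ FH'); apply: (PH _ FH').1 => //.
        by move: Hu; apply: setSU.
      - apply: (sub _ FH); apply: (PH _ FH).1 => //.
        by move: Hv; apply: setSU.
  by move=> [[X /FP PX Xv]|/Gle//]; apply: PX.2; left.
have H00 : (H `|` G) (0, 0) by right.
have total v0 : exists r, (H `|` G) (v0, r).
  have [t Ht] := one_step v0 PH H00.
  set H' := [set w | _] in Ht.
  have HH' : H `|` G `<=` H'.
    by move=> [u r] Hu; exists 0, u, r; rewrite rmorph0 scale0r mul0r !addr0.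
  have PH' : P H'.
    by rewrite /P (_ : _ `|` _ = H')//; apply/setUidPl => x Gx; apply: HH'; right.
  exists t; left; apply: contrapT => nHt; apply: (Hmax H') => //; split.
    by move=> x Hx; apply: HH'; left.
  move=> /(_ (v0, t)) H'H; apply/nHt/H'H.
  by exists 1, 0, 0; rewrite rmorph1 scale1r mul1r !add0r.
have [g Hg] := choice total.
have uniq v r s : (H `|` G) (v, r) -> (H `|` G) (v, s) -> r <= s.
  move=> Hr Hs; have := PH.1 (-1) _ _ _ _ Hs Hr.
  rewrite rmorphN1 scaleN1r addNr mulN1r => /PH.2.
  have -> : p 0 = 0 by have := pZ 0 (lexx 0); rewrite rmorph0 scale0r mul0r.
  by rewrite addrC subr_le0.
have {}uniq v r s : (H `|` G) (v, r) -> (H `|` G) (v, s) -> r = s.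
  by move=> Hr Hs; apply/le_anti/andP; split; exact: uniq Hr || exact: uniq Hs.
exists g; split=> [c u v|v|v r Gv]; [|exact: PH.2|].
  by apply: uniq; [exact: Hg|exact: PH.1].
by apply: uniq; [exact: Hg|right].
Qed.

End HahnBanach.

(** * Ultrafilter limits of bounded functions, and estimates for complex norms *)

Lemma fmap_ultra (T T' : Type) (f : T -> T') (U : set_system T) :
  UltraFilter U -> UltraFilter (f @ U).
Proof.
move=> UU; split=> [|G GF UG]; first exact: fmap_proper_filter.
rewrite eqEsubset; split=> // B GB.
have [//|UB] := in_ultra_setVsetC (f @^-1` B) UU.
have /filter_ex[x []] // : G (B `&` ~` B).
by apply: filterI => //; apply: UG.
Qed.

Lemma real_bounded_ultra_cvg (R : realType) (T : Type) (U : set_system T)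
    (f : T -> R) (M : R) :
  UltraFilter U -> (forall t, `|f t| <= M) -> exists l : R, f @ U --> l.
Proof.
move=> UU fM; have := @segment_compact R (- M) M; rewrite compact_ultra => cM.
have fMU : \forall t \near U, f t \in `[- M, M].
  by apply: filterE => t /=; rewrite in_itv /= -ler_norml; exact: fM.
by have [l [_ fl]] := cM (f @ U) (fmap_ultra f UU) fMU; exists l.
Qed.

Section ComplexNorm.
Local Open Scope complex_scope.
Variable R : realType.
Implicit Types z M : R[i].

Lemma normc_le_ReIm z : `|z| <= (`|complex.Re z| + `|complex.Im z|)%:C.
Proof.
rewrite normc_def lecR -[leRHS]ger0_norm ?addr_ge0//.
rewrite -[leRHS]sqrtr_sqr ler_sqrt ?sqr_ge0// sqrrD !real_normK ?num_real//.
by rewrite addrAC lerDl mulrn_wge0// mulr_ge0.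
Qed.

Lemma normc_ge_Im z : `|complex.Im z|%:C <= `|z|.
Proof.
rewrite normc_def lecR -sqrtr_sqr ler_sqrt ?addr_ge0 ?sqr_ge0//.
by rewrite lerDr sqr_ge0.
Qed.

End ComplexNorm.

(** * Extension of functionals dominated by a seminorm *)

Section HahnBanachSeminorm.
Local Open Scope complex_scope.
Variable R : realType.

(** Domination by [p] would hold with constant 1 here; the 2 matches the complex statement, so that
    both fields share one conclusion. *)
Lemma hahn_banach_real_seminorm (V : lmodType R) (p : V -> R) (W : set (V * R^o)) :
    (forall u v, p (u + v) <= p u + p v) ->
    (forall c v, p (c *: v) = `|c| * p v) ->
    W 0 -> (forall c u v, W u -> W v -> W (c *: u + v)) ->
    (forall w, W w -> `|w.2| <= p w.1) ->
  exists F : V -> R^o, [/\ linear F, forall w, W w -> F w.1 = w.2 &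
    forall v, `|F v| <= 2 * p v].
Proof.
move=> pD pZ W0 Wlin Wp.
have [g [glin gp gW]] : exists g : V -> R,
    [/\ forall c u v, g (c *: u + v) = c * g u + g v,
    forall v, g v <= p v & forall v r, W (v, r) -> g v = r].
  apply: (hahn_banach_graph (iota := idfun)) => //.
  - by move=> c v c0; rewrite pZ ger0_norm.
  - by move=> c u v r s Wu Wv; exact: (Wlin c _ _ Wu Wv).
  - by move=> v r /Wp /=; apply: le_trans; exact: ler_norm.
exists g; split=> //; first by move=> [v r] /gW.
have gN v : - g v = g (- v).
  have := glin (-1) v 0; rewrite scaleN1r addr0 mulN1r => ->.
  have := glin (-1) 0 0; rewrite scaler0 addr0 mulN1r addNr => ->.
  by rewrite addr0.
move=> v; have pv : `|g v| <= p v.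
  rewrite ler_norml gp andbT lerNl gN (le_trans (gp _))//.
  by rewrite -scaleN1r pZ normrN normr1 mul1r.
by rewrite mulrDl mul1r ler_wpDr// (le_trans _ pv).
Qed.

(** The real part is extended to a real functional [g], and F v = g v - i g (i v) recovers the
    complex one. Bounding real and imaginary parts separately, each by [p v], costs the factor 2 but
    avoids rotating by a phase. *)
Lemma hahn_banach_complex_seminorm (V : lmodType R[i]) (p : V -> R[i])
    (W : set (V * R[i]^o)) :
    (forall u v, p (u + v) <= p u + p v) ->
    (forall c v, p (c *: v) = `|c| * p v) ->
    W 0 -> (forall c u v, W u -> W v -> W (c *: u + v)) ->
    (forall w, W w -> `|w.2| <= p w.1) ->
  exists F : V -> R[i]^o, [/\ linear F, forall w, W w -> F w.1 = w.2 &
    forall v, `|F v| <= 2 * p v].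
Proof.
move=> pD pZ W0 Wlin Wp.
have p0 : p 0 = 0 by rewrite -(scale0r 0) pZ normr0 mul0r.
have pN v : p (- v) = p v by rewrite -scaleN1r pZ normrN normr1 mul1r.
have p_ge0 v : 0 <= p v.
  by have := pD v (- v); rewrite subrr p0 pN -mulr2n pmulrn_lge0.
(* In the order of [R[i]], a nonnegative element is real; [q] is [p] with values in [R]. *)
have [q pq] : exists q, forall v, p v = (q v)%:C.
  by exists (fun v => complex.Re (p v)) => v; rewrite RRe_real// ger0_real.
have norm_i : `|'i%C| = 1 :> R[i].
  by rewrite normc_def /= expr0n add0r expr1n sqrtr1.
have qi v : q ('i%C *: v) = q v.
  by apply: complexI; rewrite -!pq pZ norm_i mul1r.
pose G := [set (w.1, complex.Re w.2) | w in W].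
have [g [glin gp gW]] : exists g : V -> R,
    [/\ forall c u v, g (c%:C *: u + v) = c * g u + g v,
    forall v, g v <= q v & forall v r, G (v, r) -> g v = r].
  apply: (@hahn_banach_graph _ _ (real_complex R)).
  - by move=> u v; rewrite -lecR rmorphD /= -!pq.
  - move=> c v c0; apply: complexI.
    by rewrite rmorphM /= -!pq pZ ger0_norm ?ler0c.
  - by exists 0.
  - move=> c _ _ _ _ [u Wu [<- <-]] [v Wv [<- <-]]; exists (c%:C *: u + v).
      exact: Wlin.
    congr pair => /=; case: u.2 => a b; case: v.2 => a' b' /=.
    by rewrite mul0r subr0.
  - move=> _ _ [w Ww [<- <-]]; rewrite -lecR -pq (le_trans _ (Wp _ Ww))//.
    by rewrite (le_trans _ (normc_ge_Re _))// lecR ler_norm.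
have g0 : g 0 = 0.
  by have := glin (-1) 0 0; rewrite scaler0 addr0 mulN1r addNr.
have gD u v : g (u + v) = g u + g v.
  by have := glin 1 u v; rewrite scale1r mul1r.
have gZ c v : g (c%:C *: v) = c * g v.
  by have := glin c v 0; rewrite !addr0 g0 addr0.
have gN v : g (- v) = - g v.
  by have := gZ (-1) v; rewrite rmorphN1 scaleN1r mulN1r.
have gnorm v : `|g v| <= q v.
  rewrite ler_norml gp andbT lerNl -gN (le_trans (gp _))//.
  by rewrite -lecR -!pq pN.
have gM a b v : g ((a +i* b) *: v) = a * g v + b * g ('i%C *: v).
  have -> : (a +i* b) *: v = a%:C *: v + b%:C *: ('i%C *: v).
    rewrite scalerA -scalerDl; congr (_ *: _).
    by apply/eqP; rewrite eq_complex /=; apply/andP; split; apply/eqP; ring.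
  by rewrite gD !gZ.
have gMi a b v : g ('i%C *: ((a +i* b) *: v)) = a * g ('i%C *: v) - b * g v.
  have -> : 'i%C *: ((a +i* b) *: v) = ((- b) +i* a) *: v.
    rewrite scalerA; congr (_ *: _).
    by apply/eqP; rewrite eq_complex /=; apply/andP; split; apply/eqP; ring.
  by rewrite gM mulNr addrC.
exists (fun v => g v -i* g ('i%C *: v)); split.
- move=> [a b] u v.
  rewrite scalerDr !gD gM gMi; apply/eqP; rewrite eq_complex /=.
  by apply/andP; split; apply/eqP; ring.
- move=> [v [a b]] Wv /=; have -> : g v = a by apply: gW; exists (v, a +i* b).
  have Wiv : W ('i%C *: v, 'i%C * (a +i* b)).
    by have := Wlin 'i%C _ _ Wv W0; rewrite addr0.
  have -> : g ('i%C *: v) = - b.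
    by apply: gW; exists ('i%C *: v, 'i%C * (a +i* b)) => //; congr pair; simpc.
  by rewrite opprK.
- move=> v; rewrite (le_trans (normc_le_ReIm _))//= normrN.
  have -> : 2 * p v = (q v + q v)%:C by rewrite rmorphD /= -pq mulr_natl mulr2n.
  by rewrite lecR lerD// -[leRHS]qi.
Qed.

End HahnBanachSeminorm.

Section ScalarField.
Local Open Scope complex_scope.
Variables (K : numFieldType) (hK : real_or_complex K).

Lemma bounded_ultra_cvg (T : Type) (U : set_system T) (f : T -> K^o) (M : K) :
  UltraFilter U -> (forall t, `|f t| <= M) -> exists l : K^o, f @ U --> l.
Proof.
move: f M; case: K / hK => R f M UU fM; first exact: real_bounded_ultra_cvg fM.
have [t0 _] := filter_ex (@filterT _ U _).
have MR : (complex.Re M)%:C = M by rewrite RRe_real// ger0_real// (le_trans _ (fM t0)).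
have fRe t : `|complex.Re (f t)| <= complex.Re M.
  by rewrite -lecR MR (le_trans _ (fM t))//; exact: normc_ge_Re.
have fIm t : `|complex.Im (f t)| <= complex.Re M.
  by rewrite -lecR MR (le_trans _ (fM t))//; exact: normc_ge_Im.
have [x fx] := real_bounded_ultra_cvg UU fRe.
have [y fy] := real_bounded_ultra_cvg UU fIm.
exists (x +i* y); apply/cvgrPdist_le => /= eps eps0.
have epsR : (complex.Re eps)%:C = eps by rewrite RRe_real// gtr0_real.
have {}eps0 : 0 < complex.Re eps / 2 by rewrite divr_gt0// -ltcR epsR.
have hx : \forall t \near U, `|x - complex.Re (f t)| <= complex.Re eps / 2.
  by move/cvgrPdist_le : fx; exact.
have hy : \forall t \near U, `|y - complex.Im (f t)| <= complex.Re eps / 2.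
  by move/cvgrPdist_le : fy; exact.
apply: filterS2 hx hy => t hx hy.
rewrite (le_trans (normc_le_ReIm _))// -epsR lecR [leRHS]splitr.
by move: hx hy; case: (f t) => u v /= hx hy; exact: lerD.
Qed.

Lemma hahn_banach_seminorm (V : lmodType K) (p : V -> K) (W : set (V * K^o)) :
    (forall u v, p (u + v) <= p u + p v) ->
    (forall c v, p (c *: v) = `|c| * p v) ->
    W 0 -> (forall c u v, W u -> W v -> W (c *: u + v)) ->
    (forall w, W w -> `|w.2| <= p w.1) ->
  exists F : V -> K^o, [/\ linear F, forall w, W w -> F w.1 = w.2 &
    forall v, `|F v| <= 2 * p v].
Proof.
case: K / hK V p W => R V p W.
  exact: hahn_banach_real_seminorm.
exact: hahn_banach_complex_seminorm.
Qed.

End ScalarField.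

(** * Weak* limits in the dual of LUC(A) *)

Section Preliminaries.
Context {K : numFieldType}.

Lemma lspan_min (V : lmodType K) (E P : set V) :
    E `<=` P -> P 0 -> (forall c u v, P u -> P v -> P (c *: u + v)) ->
  lspan E `<=` P.
Proof.
move=> EP P0 Plin _ [n [c [x [Ex ->]]]]; elim: n c x Ex => [|n IHn] c x Ex.
  by rewrite big_ord0.
rewrite big_ord_recl; apply: Plin; first exact: EP.
exact: (IHn (fun i => c (lift ord0 i)) (fun i => x (lift ord0 i))).
Qed.

Lemma cvg_norm_le (V : normedModType K) (T : Type) (F : set_system T)
    {FF : ProperFilter F} (f : T -> V) (l : V) (M : K) :
  f @ F --> l -> (forall t, `|f t| <= M) -> `|l| <= M.
Proof.
move=> fl fM; apply/ler_addgt0Pl => eps eps0.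
have /filter_ex[t lt] : \forall t \near F, `|l - f t| <= eps.
  by move/cvgrPdist_le : fl; exact.
by rewrite -[l](subrK (f t)) (le_trans (ler_normD _ _))// lerD.
Qed.

Lemma bounded_set_ex_gt0 (V : normedModType K) (B : set V) :
  bounded_set B -> exists2 M : K, 0 < M & forall x, B x -> `|x| <= M.
Proof. by move=> /pinfty_ex_gt0[M M0 BM]; exists M. Qed.

Lemma linear_0_of (U V : lmodType K) (f : U -> V) : linear f -> f 0 = 0.
Proof.
by move=> lf; have := lf (-1) 0 0; rewrite scaler0 addr0 scaleN1r addNr.
Qed.

Lemma linear_D_of (U V : lmodType K) (f : U -> V) :
  linear f -> {morph f : x y / x + y}.
Proof. by move=> lf x y; have := lf 1 x y; rewrite !scale1r. Qed.

Lemma linear_Z_of (U V : lmodType K) (f : U -> V) : linear f -> scalable f.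
Proof. by move=> lf c x; have := lf c x 0; rewrite !addr0 (linear_0_of lf) addr0. Qed.

Lemma linear_sum_of (U V : lmodType K) (f : U -> V) n (x : 'I_n -> U) :
  linear f -> f (\sum_i x i) = \sum_i f (x i).
Proof. by move=> lf; apply: big_morph; [exact: linear_D_of|exact: linear_0_of]. Qed.

Lemma linear_B_of (U V : lmodType K) (f : U -> V) x y :
  linear f -> f (x - y) = f x - f y.
Proof.
by move=> lf; rewrite (linear_D_of lf) -scaleN1r (linear_Z_of lf) scaleN1r.
Qed.

Lemma dual_linear (U : normedModType K) (S : dual U) : linear S.
Proof. by have /in_dual_pred[] := valP S. Qed.

Lemma dual_opnorm (U : normedModType K) (S : dual U) : exists M, opnorm_le S M.
Proof. by have /in_dual_pred[] := valP S. Qed.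

Lemma dual_of_linear (U : normedModType K) (f : U -> K^o) M :
  linear f -> opnorm_le f M -> exists S : dual U, dual_fun S = f.
Proof.
move=> lf fM; have df : f \in dual_pred U by apply/in_dual_pred; split=> //; exists M.
by exists (Dual df).
Qed.

Lemma dual_continuous_cvg (U : normedModType K) (S : dual U) (T : Type)
    (F : set_system T) (f : T -> U) (l : U) :
  Filter F -> f @ F --> l -> S (f t) @[t --> F] --> S l.
Proof.
move=> FF fl; have /asboolP[_ cS] := valP S.
exact: (@cvg_comp _ _ _ f S F _ _ fl (cS l)).
Qed.

End Preliminaries.

Section Luc.
Context {K : numFieldType} (hK : real_or_complex K) {A : banachAlgType K}.

(** A form of Banach-Alaoglu: for each [F] the scalars [phi t F] are bounded, hence converge along
    [U], and linearity and the bound pass to the limit. It serves for the embedding of multipliers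
    and again for the cluster points. *)
Lemma luc_ultralimit (T : Type) (U : set_system T) (phi : T -> luc A -> K^o) C :
    UltraFilter U -> (forall t, linear (phi t)) ->
    (forall t, lucdual_norm_le (phi t) C) ->
  exists Psi : lucdual A, (forall F, phi t F @[t --> U] --> Psi F) /\
    lucdual_norm_le Psi C.
Proof.
move=> UU lphi bphi; have [t0 _] := filter_ex (@filterT _ U _).
have C0 : 0 <= C := (bphi t0).1.
have cvF (F : luc A) : exists l : K^o, phi t F @[t --> U] --> l.
  have [N FN] := dual_opnorm F.
  by apply: (bounded_ultra_cvg hK (M := C * N)) => t; apply: (bphi t).2.
have [Psi Psicvg] := choice cvF.
have lPsi : linear Psi.
  move=> c F G; apply: norm_cvg_unique (Psicvg _) _.
  rewrite (_ : (fun t => phi t (c *: F + G)) =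
    (c \*: (fun t => phi t F)) + (fun t => phi t G)); last first.
    by apply/funext => t; rewrite lphi.
  by apply: cvgD; [apply: cvgZl_tmp|]; exact: Psicvg.
have bPsi : lucdual_norm_le Psi C.
  split=> // F N FN; apply: (cvg_norm_le (Psicvg F)) => t.
  exact: (bphi t).2.
by exists (LUCDual lPsi (ex_intro _ C bPsi)).
Qed.

Section ApproximateIdentity.
Context {d : Order.disp_t} {D : preorderType d} (e : D -> A).
Hypothesis he : bounded_approximate_identity e.

Lemma tails_proper : ProperFilter (tails (D := D)).
Proof.
have [[i0 _] dir _ _] := he; apply: Build_ProperFilter_ex.
  by move=> B [i Bi]; exists i; exact: Bi.
split; first by exists i0.
  move=> B C [i Bi] [j Cj]; have [k [ik jk]] := dir i j; exists k => l kl.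
  by split; [apply/Bi/(le_trans ik)|apply/Cj/(le_trans jk)].
by move=> B C BC [i Bi]; exists i => j /Bi/BC.
Qed.

(** On a generator S . a the net is S (a R(e_i)) = S (R (a e_i)), which tends to S (R a).
    Convergence passes to spans and, as R(e_i) is bounded, to the norm closure by an eps/3
    argument. *)
Lemma rmult_image_exists E (R : rmultiplier A) M :
    (forall i, `|e i| <= E) -> opnorm_le R M ->
  exists Phi, is_rmult_image e R Phi /\ lucdual_norm_le Phi (M * E).
Proof.
move=> eE [M0 RM]; have tF := tails_proper.
have [[i0 _] _ _ cve] := he.
have E0 : 0 <= E := le_trans (normr_ge0 _) (eE i0).
have ReE i : `|R (e i)| <= M * E by rewrite (le_trans (RM _))// ler_wpM2l.
have ME0 : 0 <= M * E by rewrite mulr_ge0.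
(* An ultrafilter finer than the tails only names the candidate [Phi]; convergence along the whole
   net is proved afterwards. *)
have [U [UU tU]] := ultraFilterLemma tF.
have [||Phi [Phicvg Phib]] :=
    @luc_ultralimit _ U (fun i F => F (R (e i))) (M * E) UU.
- by move=> i c F G.
- move=> i; split=> // F N [N0 FN].
  by rewrite (le_trans (FN _))// mulrC ler_wpM2r.
exists Phi; split=> // F.
have cvG : lspan [set dual_mul S a | S in setT & a in setT] `<=`
    [set G : dual A | exists l : K^o, G (R (e i)) @[i --> tails (D := D)] --> l].
  apply: lspan_min.
  - move=> _ [S _ [a _ <-]]; exists (S (R a)) => /=.
    rewrite (_ : (fun i => _) = (fun i => S (R (bmul a (e i))))); last first.
      by apply/funext => i; rewrite rmult_mul.
    apply: dual_continuous_cvg.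
    exact: (@cvg_comp _ _ _ _ R _ _ _ (cve a).1 (@rmult_continuous _ _ R a)).
  - by exists 0; exact: cvg_cst.
  - move=> c G G' [l Gl] [l' Hl]; exists (c *: l + l').
    exact: (cvgD (cvgZl_tmp (k := c) Gl) Hl).
have /asboolP hF := valP F.
have F1 : 0 < M * E + 1 by rewrite ltr_wpDl.
apply/cvgrPdist_le => eps eps0.
(* Since |R(e_i)| <= M * E, approximating [F] within [d'] changes the values by at most eps / 3; the
   + 1 avoids dividing by 0. *)
pose d' := eps / 3 / (M * E + 1).
have d'0 : 0 < d' by rewrite !divr_gt0.
have d'le : d' * (M * E) <= eps / 3.
  rewrite -[leRHS](divfK (negbT (gt_eqF F1))) ler_wpM2l//.
    exact: ltW.
  by rewrite lerDl.
have [G /cvG[l Gl] [_ FG]] := hF d' d'0.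
have FGe i : `|F (R (e i)) - G (R (e i))| <= eps / 3.
  by apply: le_trans d'le; apply: le_trans (FG (R (e i))) _; rewrite ler_wpM2l// ltW.
have PhiF : `|Phi F - l| <= eps / 3.
  apply: (@cvg_norm_le _ _ _ U _ (fun i => F (R (e i)) - G (R (e i)))) FGe.
  by apply: cvgB; [exact: Phicvg|exact: (cvg_trans (cvg_app _ tU) Gl)].
have hG : \forall i \near tails (D := D), `|l - G (R (e i))| <= eps / 3.
  by move/cvgrPdist_le : Gl; apply; rewrite divr_gt0.
apply: filterS hG => i hG.
have -> : Phi F - F (R (e i)) =
    (Phi F - l) + (l - G (R (e i))) - (F (R (e i)) - G (R (e i))).
  by rewrite opprB !subrKA.
rewrite (le_trans (ler_normB _ _))// (le_trans (lerD (ler_normD _ _) (lexx _)))//.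
apply: (le_trans (lerD (lerD PhiF hG) (FGe i))).
by have -> : eps / 3 + eps / 3 + eps / 3 = eps by field.
Qed.

(** Both sides are the limit of T (x R(e_i)) = T (R (x e_i)): a multiplier acts on the dual as the
    adjoint of [R]. *)
Lemma rmult_image_act (R : rmultiplier A) Phi (T : dual A) x :
  is_rmult_image e R Phi -> lucdual_act Phi T x = T (R x).
Proof.
move=> /(_ (luc_mul T x)) PhiT; have tF := tails_proper.
have [_ _ _ cve] := he.
apply: (@norm_cvg_unique _ _ _ _ _ _ PhiT) => /=.
rewrite (_ : (fun i => _) = (fun i => T (R (bmul x (e i))))); last first.
  by apply/funext => i; rewrite rmult_mul.
apply: dual_continuous_cvg.
exact: (@cvg_comp _ _ _ _ R _ _ _ (cve x).1 (@rmult_continuous _ _ R x)).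
Qed.

(** The last clause is the concrete description of Psi . T on which the later arguments rest. [C]
    does not depend on [p] or [k], which makes the chosen tuples a bounded family. *)
Lemma cluster_point {d'} {eta : orderType d'} m (a : eta -> 'I_m -> rmultiplier A) M :
    (forall i k, opnorm_le (a i k) M) ->
  exists C, forall (p : set_system eta) k, cofinal_ultrafilter p ->
    exists Psi, [/\ cluster_set e a k Psi, lucdual_norm_le Psi C &
      forall (T : dual A) x, T (a i k x) @[i --> p] --> lucdual_act Psi T x].
Proof.
move=> aM; have [_ _ /bounded_set_ex_gt0[E _ eE] _] := he.
have {}eE i : `|e i| <= E by apply: eE; exists i.
exists (M * E) => p k [pU pc].
have [Phi hPhi] := choice (fun i => rmult_image_exists eE (aM i k)).
have [Psi [Psicvg Psib]] := luc_ultralimit pU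
  (fun i => lucdual_linear (Phi i)) (fun i => (hPhi i).2).
exists Psi; split=> [|//|T x].
  by exists p; split=> //; exists Phi; split=> // i; exact: (hPhi i).1.
rewrite (_ : (fun i => _) = (fun i => Phi i (luc_mul T x))); first exact: Psicvg.
by apply/funext => i; rewrite -(rmult_image_act T x (hPhi i).1).
Qed.

End ApproximateIdentity.
End Luc.

(** * Initial ordinals and cofinal ultrafilters *)

Section Cardinals.
Local Open Scope card_scope.

Lemma ex_choice (T U : Type) (P : T -> U -> Prop) :
  (forall x, exists y, P x y) -> exists f : T -> U, forall x, P x (f x).
Proof. by move=> /choice[f Pf]; exists f. Qed.

Lemma card_le_ex (T U : Type) (A : set T) (B : set U) (u0 : U) :
  A #<= B -> exists2 f : T -> U, set_fun A B f & set_inj A f.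
Proof. by case/card_leP => f; apply/injfunPex; squash (valLR u0 f). Qed.

Lemma ex_card_le (T U : Type) (A : set T) (B : set U) (f : T -> U) :
  set_fun A B f -> set_inj A f -> A #<= B.
Proof.
move=> fAB fI; have /injfunPex[g] : exists2 f, set_fun A B f & set_inj A f.
  by exists f.
exact: inj_card_le.
Qed.

(** A maximal partial injection, given by its graph, is total on [A] or onto [B]; otherwise a
    missing pair could be added. *)
Lemma card_le_total (T U : Type) (A : set T) (B : set U) : A #<= B \/ B #<= A.
Proof.
pose P (G : set (T * U)) := (forall w, G w -> A w.1 /\ B w.2) /\
  forall w w', G w -> G w' -> (w.1 = w'.1 <-> w.2 = w'.2).
have [F FP Ftot|G [[GAB GI] Gmax]] := @Zorn_bigcup _ P.
  split=> [w [X FX]|w w' [X FX Xw] [X' FX' Xw']]; first exact: (FP _ FX).1.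
  by have [XX'|X'X] := Ftot _ _ FX FX';
    [apply: (FP _ FX').2 => //; exact: XX'|apply: (FP _ FX).2 => //; exact: X'X].
have [Gtot|] := pselect (forall x, A x -> exists y, G (x, y)).
  left; have [[y0 _]|] := pselect (exists y : U, True); last first.
    move=> nU; have -> : A = set0; last exact: card_ge0.
    by apply/seteqP; split=> // x /Gtot[y _]; apply: nU; exists y.
  have [f fG] : exists f : T -> U, forall x, A x -> G (x, f x).
    apply: (@ex_choice _ _ (fun x y => A x -> G (x, y))) => x.
    by have [/Gtot[y]|nA] := pselect (A x); [exists y|exists y0].
  apply: (@ex_card_le _ _ _ _ f) => [x /fG/GAB[]//|x x' /set_mem Ax /set_mem Ax' ff].
  exact: ((GI _ _ (fG _ Ax) (fG _ Ax')).2 ff).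
move=> /existsNP[x0 /not_implyP[Ax0 nx0]].
have [Gsurj|] := pselect (forall y, B y -> exists x, G (x, y)).
  right; have [f fG] : exists f : U -> T, forall y, B y -> G (f y, y).
    apply: (@ex_choice _ _ (fun y x => B y -> G (x, y))) => y.
    by have [/Gsurj[x]|nB] := pselect (B y); [exists x|exists x0].
  apply: (@ex_card_le _ _ _ _ f) => [y /fG/GAB[]//|y y' /set_mem By /set_mem By' ff].
  exact: ((GI _ _ (fG _ By) (fG _ By')).1 ff).
move=> /existsNP[y0 /not_implyP[By0 ny0]]; exfalso.
apply: (Gmax (G `|` [set (x0, y0)])).
  split; first exact: subsetUl.
  by move=> /(_ (x0, y0)) GG; apply: nx0; exists y0; apply: GG; right.
split=> [w [/GAB//|->//]|[x y] [x' y'] [Gw|[-> ->]] [Gw'|[-> ->]] /=]; last by [].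
- exact: (GI _ _ Gw Gw').
- by split=> xy; [case: nx0; exists y; rewrite -xy|case: ny0; exists x; rewrite -xy].
- by split=> xy; [case: nx0; exists y'; rewrite xy|case: ny0; exists x'; rewrite xy].
Qed.

(* Hessenberg's theorem. An injection [f : Y * Y -> Y], maximal for extension,
   is defined on a set [Y] of full cardinality: otherwise the complement of [Y]
   contains a copy [Z] of [Y], and [f] extends to [Y `|` Z] since
   the three new products embed in [Z]. *)
Lemma infinite_square (X : Type) :
  infinite_set [set: X] -> exists f : X * X -> X, injective f.
Proof.
move=> infX; have [x0 _] := infinite_setN0 infX.
move/infiniteP : infX => /(card_le_ex x0)[n_ _ nI].
have {}nI : injective n_ by move=> i j; apply: nI; exact/mem_set.
pose P (Yf : set X * (X * X -> X)) := let: (Y, f) := Yf in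
  [/\ forall n, Y (n_ n), forall x y, Y x -> Y y -> Y (f (x, y)) &
    forall x y x' y', Y x -> Y y -> Y x' -> Y y' -> f (x, y) = f (x', y') ->
      x = x' /\ y = y'].
pose le (s t : {Yf | P Yf}) := `[< (sval s).1 `<=` (sval t).1 /\
  forall x y, (sval s).1 x -> (sval s).1 y -> (sval s).2 (x, y) = (sval t).2 (x, y) >].
have le_refl s : le s s by apply/asboolP; split.
have [g gn] : exists g : X -> nat, forall n, g (n_ n) = n.
  have [g gn] : exists g : X -> nat, forall x, (exists n, n_ n = x) -> n_ (g x) = x.
    apply: (@ex_choice _ _ (fun x m => (exists n, n_ n = x) -> n_ m = x)) => x.
    by have [[n nx]|] := pselect (exists n, n_ n = x); [exists n|exists 0%N].
  by exists g => n; apply: nI; apply: gn; exists n.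
(* Starting point for Zorn's lemma: a copy of the natural numbers with their pairing function. *)
have P0 : P (range n_, fun xy => n_ (pickle (g xy.1, g xy.2))).
  split=> [n|x y _ _|x y x' y' [i _ <-] [j _ <-] [i' _ <-] [j' _ <-]] /=.
  - by exists n.
  - by eexists.
  - by rewrite !gn => /nI/(pcan_inj pickleK)[-> ->].
suff [[[Y f] Pmax] max] : exists t, premaximal le t.
  have [Yn Yf fI] := Pmax.
  have [/(card_le_ex x0)[h hY hI]|/(card_le_ex x0)[h hY hI]] := card_le_total Y (~` Y).
    exfalso; pose Z := h @` Y.
    have [k kh] : exists k : X -> X, forall y, Y y -> k (h y) = y.
      have [k kh] : exists k : X -> X, forall z, Z z -> Y (k z) /\ h (k z) = z.
        apply: (@ex_choice _ _ (fun z y => Z z -> Y y /\ h y = z)) => z.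
        by have [[y Yy yz]|] := pselect (Z z); [exists y|exists x0].
      exists k => y Yy; have [|Yk hk] := kh (h y); first by exists y.
      by apply: hI => //; exact/mem_set.
    pose r x := if `[< Y x >] then x else k x.
    (* One of four tags, recording which of [x] and [y] lie in [Y]. With the tag, the
       representatives [r x] and [r y] in [Y] determine [x] and [y]. *)
    pose c x y := n_ (`[< Y x >] + `[< Y y >].*2)%N.
    pose f' xy := if `[< Y xy.1 >] && `[< Y xy.2 >] then f xy
      else h (f (c xy.1 xy.2, f (r xy.1, r xy.2))).
    have Yr x : (Y `|` Z) x -> Y (r x).
      by rewrite /r; case: asboolP => // nYx [//|[y Yy <-]]; rewrite kh.
    have rI x x' : (Y `|` Z) x -> (Y `|` Z) x' -> `[< Y x >] = `[< Y x' >] ->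
        r x = r x' -> x = x'.
      rewrite /r; case: asboolP => [Yx _ _ <-//|nYx].
      by move=> [//|[y Yy <-]] [Yx' /esym/asboolPn//|[y' Yy' <-]] <-; rewrite !kh// => ->.
    have YF u v : (Y `|` Z) u -> (Y `|` Z) v -> Y (f (c u v, f (r u, r v))).
      by move=> YZu YZv; exact: (Yf _ _ (Yn _) (Yf _ _ (Yr _ YZu) (Yr _ YZv))).
    have PYZ : P (Y `|` Z, f').
      split=> [n|x y YZx YZy|x y x' y' YZx YZy YZx' YZy']; first by left.
        rewrite /f' /=; case: asboolP => [Yx|_]; case: asboolP => [Yy|_] /=;
          by [left; exact: Yf|right; exists (f (c x y, f (r x, r y))) => //; exact: YF].
      rewrite /f' /=; case: ifPn => [/andP[/asboolP Yx /asboolP Yy]|nxy];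
        case: ifPn => [/andP[/asboolP Yx' /asboolP Yy']|nxy'].
      - exact: fI.
      - by move=> E; case: (hY _ (YF _ _ YZx' YZy')); rewrite -E; exact: Yf.
      - by move=> E; case: (hY _ (YF _ _ YZx YZy)); rewrite E; exact: Yf.
      move=> /hI E; have {}E : f (c x y, f (r x, r y)) = f (c x' y', f (r x', r y')).
        by apply: E; apply/mem_set; exact: YF.
      have [cc rr] := fI _ _ _ _ (Yn _) (Yf _ _ (Yr _ YZx) (Yr _ YZy))
        (Yn _) (Yf _ _ (Yr _ YZx') (Yr _ YZy')) E.
      have [rx ry] := fI _ _ _ _ (Yr _ YZx) (Yr _ YZy) (Yr _ YZx') (Yr _ YZy') rr.
      have [xx yy] : `[< Y x >] = `[< Y x' >] /\ `[< Y y >] = `[< Y y' >].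
        move/nI : cc; case: `[< Y x >]; case: `[< Y y >];
          by case: `[< Y x' >]; case: `[< Y y' >].
      by split; exact: rI.
    have : le (exist P _ Pmax) (exist P _ PYZ).
      apply/asboolP; split=> [|x y Yx Yy] /=; first exact: subsetUl.
      by rewrite /f' /= !asboolT.
    move=> /max/asboolP[/= YZY _]; apply: (hY (n_ 0%N)) => //.
    by apply: YZY; right; exists (n_ 0%N).
  (* Now the complement of [Y] embeds in [Y], hence so does all of [X]: the tags [n_ 0] and [n_ 1]
     keep the two pieces apart. *)
  pose s x := if `[< Y x >] then f (n_ 0%N, x) else f (n_ 1%N, h x).
  have Ys x : Y (s x) by rewrite /s; case: asboolP => [|/hY] Yx; exact: Yf.
  have sI : injective s.
    move=> x y; rewrite /s; case: asboolP => Yx; case: asboolP => Yy E.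
    - by have [] := fI _ _ _ _ (Yn _) Yx (Yn _) Yy E.
    - by have [/nI] := fI _ _ _ _ (Yn _) Yx (Yn _) (hY _ Yy) E.
    - by have [/nI] := fI _ _ _ _ (Yn _) (hY _ Yx) (Yn _) Yy E.
    have [_ hxy] := fI _ _ _ _ (Yn _) (hY _ Yx) (Yn _) (hY _ Yy) E.
    by apply: hI => //; exact/mem_set.
  exists (fun xy => f (s xy.1, s xy.2)) => -[x y] [x' y'] /= E.
  by have [/sI-> /sI->] := fI _ _ _ _ (Ys _) (Ys _) (Ys _) (Ys _) E.
apply: (@ZL_preorder {Yf | P Yf} (exist P _ P0) le) => [//||C Ctot].
- move=> r s t /asboolP[rs frs] /asboolP[st fst]; apply/asboolP; split.
    exact: subset_trans st.
  by move=> x y rx ry; rewrite frs// fst//; exact: rs.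
- have [[t0 Ct0]|C0] := pselect (C !=set0); last first.
    by exists (exist P _ P0) => s Cs; case: C0; exists s.
  pose Y := \bigcup_(t in C) (sval t).1.
  have common t t' : C t -> C t' -> exists s, [/\ C s, le t s & le t' s].
    by move=> Ct Ct'; have [?|?] := Ctot _ _ Ct Ct'; [exists t'|exists t].
  have [f fC] : exists f : X * X -> X, forall xy t, C t ->
      (sval t).1 xy.1 -> (sval t).1 xy.2 -> f xy = (sval t).2 xy.
    apply: (@ex_choice _ _ (fun xy z => forall t, C t -> (sval t).1 xy.1 ->
      (sval t).1 xy.2 -> z = (sval t).2 xy)) => -[x y] /=.
    have [[t [Ct tx ty]]|nt] := pselect (exists t, [/\ C t, (sval t).1 x & (sval t).1 y]).
      exists ((sval t).2 (x, y)) => t' Ct' t'x t'y.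
      have [s [_ /asboolP[_ ts] /asboolP[_ t's]]] := common _ _ Ct Ct'.
      by rewrite ts// t's.
    by exists x => t Ct tx ty; case: nt; exists t.
  have two x y : Y x -> Y y -> exists t, [/\ C t, (sval t).1 x & (sval t).1 y].
    move=> [t Ct tx] [t' Ct' t'y].
    have [s [Cs /asboolP[ts _] /asboolP[t's _]]] := common _ _ Ct Ct'.
    by exists s; split=> //; [exact: ts|exact: t's].
  have PC (t : {Yf | P Yf}) : P ((sval t).1, (sval t).2).
    by case: t => [[Z h] Pt]; exact: Pt.
  have PY : P (Y, f).
    split=> [n|x y Yx Yy|x y x' y' Yx Yy Yx' Yy'].
    - by exists t0 => //; have [] := PC t0.
    - have [t [Ct tx ty]] := two _ _ Yx Yy; exists t => //.
      by rewrite (fC (x, y) t)//; have [_ tf _] := PC t; exact: tf.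
    - have [t [Ct tx ty]] := two _ _ Yx Yy.
      have [t' [Ct' tx' ty']] := two _ _ Yx' Yy'.
      have [s [Cs /asboolP[ts _] /asboolP[t's _]]] := common _ _ Ct Ct'.
      move: (ts _ tx) (ts _ ty) (t's _ tx') (t's _ ty') => {}tx {}ty {}tx' {}ty'.
      rewrite (fC (x, y) s)// (fC (x', y') s)//.
      by have [_ _ sI] := PC s; exact: sI.
  exists (exist P _ PY) => t Ct; apply/asboolP; split=> [x tx|x y tx ty] /=.
    by exists t.
  by rewrite (fC (x, y) t).
Qed.

End Cardinals.

Section InitialOrdinal.
Local Open Scope card_scope.
Context {d : Order.disp_t} {eta : orderType d}.
Hypothesis heta : initial_ordinal eta.
Hypothesis heta_inf : infinite_set [set: eta].
Implicit Types B C : set eta.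

Local Notation full B := ([set: eta] #<= B).

Let full_ex B : full B -> exists2 f : eta -> eta, forall i, B (f i) & injective f.
Proof.
have [i0 _] := infinite_setN0 heta_inf.
move=> /(card_le_ex i0)[f fB fI]; exists f => [i|i j fij]; first exact: fB.
by apply: fI => //; exact/mem_set.
Qed.

Let ex_full B (f : eta -> eta) : (forall i, B (f i)) -> injective f -> full B.
Proof. by move=> fB fI; apply: (@ex_card_le _ _ _ _ f) => // i j _ _; apply: fI. Qed.

(** A set that misses the tail at [i] lies in the initial segment below [i], which is too small. *)
Lemma full_cofinal B (i : eta) : full B -> exists2 j, B j & (i <= j)%O.
Proof.
move=> fB; apply: contrapT => nB; have /negP := heta.2 i; apply.
apply: (card_le_trans fB); apply: subset_card_le => j Bj /=.
by rewrite ltNge; apply/negP => ij; apply: nB; exists j.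
Qed.

(** Inside [B] sits a copy of eta x eta. Either some row lies wholly in [B1], or every row has a
    point outside [B1], and one such point per row gives a copy of eta in [B2]. *)
Lemma full_setU B B1 B2 : full B -> B `<=` B1 `|` B2 -> full B1 \/ full B2.
Proof.
move=> /full_ex[f fB fI] BB; have [g gI] := infinite_square heta_inf.
have [[l hl]|nl] := pselect (exists l, forall i, B1 (f (g (l, i)))).
  by left; apply: (ex_full hl) => i j /fI/gI[].
right; have /choice[s hs] : forall l, exists i, ~ B1 (f (g (l, i))).
  by move=> l; apply: contrapT => n; apply: nl; exists l => i; apply: contrapT => ?;
     apply: n; exists i.
apply: (@ex_full _ (fun l => f (g (l, s l)))) => [l|l l' /fI/gI[]//].
by have [/hs|] := BB _ (fB (g (l, s l))).
Qed.

Lemma full_tail (i : eta) : full [set j | (i <= j)%O].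
Proof.
have [j _|/(negP (heta.2 i))|] // := @full_setU setT [set j | (j < i)%O]
  [set j | (i <= j)%O] (card_lexx _).
by case: (ltP j i) => ij; [left|right].
Qed.

Lemma full_pigeonhole (I : eqType) (s : seq I) (P : I -> set eta) B :
    full B -> (forall i, B i -> exists2 k, k \in s & P k i) ->
  exists2 k, k \in s & full (P k).
Proof.
elim: s B => [|k s IHs] B fB BP.
  have [i0 _] := infinite_setN0 heta_inf.
  by have [j /BP[]] := full_cofinal i0 fB.
have [|Pk|fBs] := @full_setU B (P k) (B `\` P k) fB.
- by move=> i Bi; have [?|?] := pselect (P k i); [left|right].
- by exists k; rewrite ?mem_head.
have [i [/BP[k' + Pk'i] nPki]|k' k's Pk'] := IHs _ fBs.
  by rewrite inE => /predU1P[k'k|k's]; [case: nPki; rewrite -k'k|exists k'].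
by exists k'; rewrite ?inE ?k's ?orbT.
Qed.

Lemma cofinal_ultrafilter_ex C : (forall i, exists2 j, C j & (i <= j)%O) ->
  exists p : set_system eta, cofinal_ultrafilter p /\ p C.
Proof.
move=> cofC; have [i0 _] := infinite_setN0 heta_inf.
pose F := filter_from setT (fun i => C `&` [set j | (i <= j)%O]).
have FF : ProperFilter F.
  apply: filter_from_proper; last by move=> i _; have [j] := cofC i; exists j.
  apply: filter_from_filter; first by exists i0.
  move=> i j _ _; exists (Order.max i j) => // k [Ck] /=.
  by rewrite ge_max => /andP[].
have [p [pU Fp]] := ultraFilterLemma FF; exists p; split; last first.
  by apply: Fp; exists i0 => // ? [].
split=> // B pB i; have pi : p (C `&` [set j | (i <= j)%O]) by apply: Fp; exists i.
by have [j [Bj [_ ij]]] := @filter_ex _ p _ _ (filterI pB pi); exists j.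
Qed.

(** The disjoint sets are the fibres of a labelling [lam], which later also tells which functional
    to prescribe at an index. The fibre of [l] contains the l-th row of a square inside [B]. *)
Lemma cofinal_ultrafilter_family B : full B ->
  exists (lam : eta -> eta) (p : eta -> set_system eta), forall l,
    cofinal_ultrafilter (p l) /\ p l [set i | B i /\ lam i = l].
Proof.
move=> /full_ex[f fB fI]; have [g gI] := infinite_square heta_inf.
have [lam hlam] : exists lam : eta -> eta, forall l i, lam (f (g (l, i))) = l.
  have [lam hlam] : exists lam : eta -> eta, forall j l i, f (g (l, i)) = j -> lam j = l.
    apply: (@ex_choice _ _ (fun j l' => forall l i, f (g (l, i)) = j -> l' = l)) => j.
    have [[l [i fij]]|n] := pselect (exists l i, f (g (l, i)) = j).
      by exists l => l' i'; rewrite -fij => /fI/gI[].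
    (* Indices off the square may carry any label: fibres stay disjoint and still contain their
       rows. *)
    by exists j => l i lij; case: n; exists l, i.
  by exists lam => l i; exact: hlam.
exists lam; apply: (@ex_choice _ _ (fun l (p : set_system eta) =>
  cofinal_ultrafilter p /\ p [set i | B i /\ lam i = l])) => l.
apply: cofinal_ultrafilter_ex => i.
apply: full_cofinal; apply: (@ex_full _ (fun i => f (g (l, i)))) => [j|j k /fI/gI[]//].
by split=> //.
Qed.

End InitialOrdinal.

(** * Interpolation on bases *)

Section Spans.
Context {K : numFieldType}.
Implicit Types V W : lmodType K.

Lemma lspan_sum V (E : set V) (I : Type) (r : seq I) (P : pred I) (F : I -> V) :
  (forall i, P i -> lspan E (F i)) -> lspan E (\sum_(i <- r | P i) F i).
Proof.
move=> EF; have [E0 Elin] := lspan_submod E.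
by apply: big_ind => // u v Eu Ev; rewrite -[u]scale1r; exact: Elin.
Qed.

Lemma lspanZ V (E : set V) c u : lspan E u -> lspan E (c *: u).
Proof.
by move=> Eu; have [E0 Elin] := lspan_submod E; rewrite -[_ *: _]addr0; exact: Elin.
Qed.

Lemma lspan_mono V (E F : set V) : E `<=` F -> lspan E `<=` lspan F.
Proof.
by move=> EF; apply: lspan_min; [move=> x /EF; exact: sub_lspan|exact: (lspan_submod F).1
  |exact: (lspan_submod F).2].
Qed.

Lemma lspan_image V W (f : V -> W) (E : set V) :
  linear f -> lspan (f @` E) = f @` lspan E.
Proof.
move=> lf; apply/seteqP; split.
  apply: lspan_min.
  - by move=> _ [x Ex <-]; exists x => //; exact: sub_lspan.
  - by exists 0; [exact: (lspan_submod E).1|exact: linear_0_of].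
  - move=> c _ _ [u Eu <-] [v Ev <-]; exists (c *: u + v); last exact: lf.
    exact: (lspan_submod E).2.
move=> _ [x Ex <-]; apply: (lspan_min (P := [set x | lspan (f @` E) (f x)]) _ _ _ Ex).
- by move=> u Eu; apply: sub_lspan; exists u.
- by rewrite /= (linear_0_of lf); exact: (lspan_submod _).1.
- by move=> c u v; rewrite /= lf; exact: (lspan_submod _).2.
Qed.

Lemma lspan_set1 V (v w : V) : lspan [set v] w -> exists c, w = c *: v.
Proof.
apply: (lspan_min (P := [set w | exists c, w = c *: v])) =>
    [_ ->||c _ _ [b ->] [b' ->]].
- by exists 1; rewrite scale1r.
- by exists 0; rewrite scale0r.
- by exists (c * b + b'); rewrite scalerDl scalerA.
Qed.

(** Terms with a common index are collected, so that estimates for distinct indices apply.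
    Nonemptiness of [E (alpha n)] gives back any side condition on the index built into [E]. *)
Lemma lspan_bigcup V (I : eqType) (E : I -> set V) w : lspan (\bigcup_i E i) w ->
  exists p (alpha : 'I_p -> I) (y : 'I_p -> V),
    [/\ injective alpha, forall n, E (alpha n) !=set0,
      forall n, lspan (E (alpha n)) (y n) & w = \sum_n y n].
Proof.
move=> [n [c [x [Ex ->]]]].
have [i Ei] : exists i : 'I_n -> I, forall j, E (i j) (x j).
  by apply: (@ex_choice _ _ (fun j k => E k (x j))) => j; have [k _ Ek] := Ex j; exists k.
pose s := undup [seq i j | j <- enum 'I_n].
have i_s j : i j \in s by rewrite mem_undup map_f// mem_enum.
have hs j : (index (i j) s < size s)%N by rewrite index_mem.
pose h j := Ordinal (hs j).
have hK j : tnth (in_tuple s) (h j) = i j.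
  by rewrite (tnth_nth (i j)) /= nth_index.
exists (size s), (tnth (in_tuple s)), (fun k => \sum_(j | h j == k) c j *: x j).
split.
- by apply/tuple_uniqP; rewrite /= undup_uniq.
- move=> k; have : tnth (in_tuple s) k \in s by exact: mem_tnth.
  by rewrite mem_undup => /mapP[j _ ->]; exists (x j).
- move=> k; apply: lspan_sum => j /eqP <-; rewrite hK; apply: lspanZ.
  exact: sub_lspan.
- by rewrite (partition_big h predT).
Qed.

End Spans.

Section Density.
Context {K : numFieldType} {A : normedModType K}.

Lemma closure_dist (E : set A) x eps :
  closure E = setT -> 0 < eps -> exists2 y, E y & `|x - y| < eps.
Proof.
move=> clE eps0; have : closure E x by rewrite clE.
move=> /(_ _ (nbhsx_ballx x eps eps0))[y [Ey]]; rewrite -ball_normE.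
by exists y.
Qed.

Lemma dual_eq_dense (S T : dual A) (E : set A) :
  closure (lspan E) = setT -> (forall x, E x -> S x = T x) -> S = T.
Proof.
move=> clE ST; apply/val_inj/funext => x /=; apply/eqP.
rewrite -subr_eq0 -normr_le0; apply/ler_addgt0Pl => eps eps0; rewrite addr0.
have [M [M0 DM]] := dual_opnorm (S - T : dual A).
have M1 : 0 < M + 1 by rewrite ltr_wpDl.
have [y Ey xy] := closure_dist x clE (divr_gt0 eps0 M1).
have STy : S y = T y.
  apply: (lspan_min (P := [set y | S y = T y])) Ey => //=.
    by rewrite (linear_0_of (dual_linear S)) (linear_0_of (dual_linear T)).
  by move=> c u v Su Sv; rewrite (dual_linear S) (dual_linear T) Su Sv.
have -> : S x - T x = (S - T : dual A) (x - y).
  transitivity (S (x - y) - T (x - y)) => //.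
  rewrite (linear_B_of _ _ (dual_linear S)) (linear_B_of _ _ (dual_linear T)).
  by rewrite STy opprB addrA subrK.
rewrite (le_trans (DM _))// (le_trans (ler_wpM2l M0 (ltW xy)))//.
by rewrite mulrCA ger_pMr// ler_pdivrMr// mul1r lerDl.
Qed.

Lemma cvg_sum_ord (T : Type) (F : set_system T) {FF : Filter F} n
    (f : 'I_n -> T -> A) (l : 'I_n -> A) :
  (forall k, f k @ F --> l k) -> \sum_k f k t @[t --> F] --> \sum_k l k.
Proof.
elim: n f l => [|n IHn] f l fl.
  by rewrite (_ : (fun t => _) = cst 0) ?big_ord0; [exact: cvg_cst
    |apply/funext => t; rewrite big_ord0].
rewrite (_ : (fun t => _) =
    f ord0 + (fun t => \sum_(k < n) f (lift ord0 k) t)); last first.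
  by apply/funext => t; rewrite big_ord_recl.
by rewrite big_ord_recl; apply: cvgD => //; exact: IHn.
Qed.

End Density.

Section HahnBanachApplications.
Context {K : numFieldType} (hK : real_or_complex K).

Lemma dual_separates (A : normedModType K) (x : A) :
  x <> 0 -> exists S : dual A, S x <> 0.
Proof.
move=> x0; have [|||||F [lF FW Fb]] := @hahn_banach_seminorm _ hK A
    (fun v => `|v|) (lspan [set (x, `|x| : K^o)]).
- exact: ler_normD.
- by move=> c v; rewrite normrZ.
- exact: (lspan_submod _).1.
- exact: (lspan_submod _).2.
- by move=> w /lspan_set1[c ->] /=; rewrite normrM normr_id normrZ.
have [S SF] : exists S : dual A, dual_fun S = F.
  by apply: (dual_of_linear (M := 2)).
exists S; rewrite SF (FW (x, `|x|)); last exact: sub_lspan.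
by move/normr0_eq0.
Qed.

(* Helly's theorem for the sum norm on [A ^ m]. *)
Lemma dual_interpolation (A : normedModType K) m (I : Type) (u : I -> 'I_m -> A)
    (s : I -> K^o) C :
    0 <= C ->
    (forall w : ('I_m -> A) * K^o, lspan (range (fun i => (u i, s i))) w ->
      `|w.2| <= C * \sum_k `|w.1 k|) ->
  exists T : 'I_m -> dual A, forall i, \sum_k T k (u i k) = s i.
Proof.
move=> C0 uC; pose p (v : 'I_m -> A) := C * \sum_k `|v k|.
have [|||||F [lF FW Fb]] := @hahn_banach_seminorm _ hK ('I_m -> A) p
    (lspan (range (fun i => (u i, s i)))).
- move=> v w; rewrite /p -mulrDr ler_wpM2l// -big_split ler_sum// => k _.
  exact: ler_normD.
- move=> c v; rewrite /p mulrCA; congr (_ * _); rewrite mulr_sumr.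
  by apply: eq_bigr => k _; rewrite normrZ.
- exact: (lspan_submod _).1.
- exact: (lspan_submod _).2.
- exact: uC.
pose delta (k : 'I_m) (x : A) : 'I_m -> A := fun j => if j == k then x else 0.
have ldelta k : linear (delta k).
  move=> c x y; apply/funext => j; rewrite /delta !fctE.
  by case: eqP => //; rewrite scaler0 addr0.
have delta_sum v : v = \sum_k delta k (v k).
  apply/funext => j; rewrite fct_sumE (bigD1 j)//= /delta eqxx big1 ?addr0// => k.
  by rewrite eq_sym => /negPf ->.
have [T hT] : exists T : 'I_m -> dual A, forall k, dual_fun (T k) = F \o delta k.
  apply: (@ex_choice _ _ (fun k (T : dual A) => dual_fun T = F \o delta k)) => k.
  apply: (dual_of_linear (M := 2 * C)) => [c x y|]; first by rewrite /= ldelta lF.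
  split=> [|x]; first by rewrite mulr_ge0.
  rewrite (le_trans (Fb _))// /p mulrA ler_wpM2l ?mulr_ge0// (bigD1 k)//= big1.
    by rewrite addr0 /delta eqxx.
  by move=> j /negPf jk; rewrite /delta jk normr0.
exists T => i; have /= <- : F (u i, s i).1 = s i.
  by apply: FW; apply: sub_lspan; exists i.
rewrite [in RHS](delta_sum (u i)) (linear_sum_of _ lF).
by apply: eq_bigr => k _; rewrite hT.
Qed.

End HahnBanachApplications.

(** * Boundedness of the prescribed functional for each type of base *)

Section BaseInequalities.
Context {K : numFieldType} {A : banachAlgType K}.
Context {d : Order.disp_t} {eta : orderType d}.
Implicit Types As : eta -> set A.

Lemma rmult_linear (R : rmultiplier A) : linear R.
Proof. by move=> c x y; exact: linearP. Qed.

(** Every p-norm is at most the 1-norm, so the exponent in a type 3 base can be forgotten. *)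
Lemma le_pnorm_sum m p (c : K) (v : 'I_m -> A) :
  0 <= c -> le_pnorm p c v -> c <= \sum_k `|v k|.
Proof.
move=> c0; have sum_ge0 : 0 <= \sum_k `|v k| by exact: sumr_ge0.
have le_sum k : `|v k| <= \sum_k `|v k|.
  by rewrite (bigD1 k)//= lerDl sumr_ge0.
case: p => [q|[k ck]]; last exact: le_trans (le_sum k).
move=> /= cq; rewrite -(@ler_pXn2r _ q.+1)// ?nnegrE//.
apply: le_trans cq _; rewrite [leRHS]exprSr mulr_sumr; apply: ler_sum => k _.
by rewrite exprSr ler_wpM2r// lerXn2r ?nnegrE.
Qed.

(** Leaves only types 1 and 3 to be estimated; [Some 0] stands for p = 1. *)
Lemma Fl1_base23 As (a : eta -> rmultiplier A) :
  Fl1_base2 As a -> Fl1_base3 As (fun i (_ : 'I_1) => a i).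
Proof.
move=> [zoom sel [C C0 aC]]; split=> //.
  rewrite (_ : (fun i => _) = fun i => a i @` As i)//; apply/funext => i.
  by rewrite bigcup_const//; exists ord0.
exists (Some 0%N), C => // i x Ax /=; rewrite expr1 big_ord1 expr1 normrZ.
by rewrite (gtr0_norm C0); exact: aC.
Qed.

Lemma Fl1_base3_lower m As (a : eta -> 'I_m -> rmultiplier A) :
  Fl1_base3 As a -> exists2 C, 0 < C & forall i x, lspan (As i) x ->
    `|x| <= C * \sum_k `|a i k x|.
Proof.
move=> [_ _ [p [C C0 aC]]]; exists C => // i x /aC /le_pnorm_sum -/(_ (normr_ge0 _)).
rewrite mulr_sumr => /le_trans; apply; apply: ler_sum => k _.
by rewrite normrZ gtr0_norm.
Qed.

Lemma Fl1_base_zooming m As (a : eta -> 'I_m -> rmultiplier A) :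
  Fl1_base As a -> zooming As a.
Proof. by case=> [b []|b []|n b []]. Qed.

Definition multiplier_graph m (a : eta -> 'I_m -> rmultiplier A) (S : eta -> dual A) i x :
  ('I_m -> A) * K^o := ((fun k => a i k x), S i x).

Lemma multiplier_graph_linear m (a : eta -> 'I_m -> rmultiplier A) S i :
  linear (multiplier_graph a S i).
Proof.
move=> c x y; congr pair; last exact: dual_linear.
by apply/funext => k; rewrite rmult_linear.
Qed.

(** |sum_n S x_n| <= M sum_n |x_n| <= M C sum_k sum_n |a^k x_n|. For fixed [k] the vectors a^k x_n
    lie in the spans of different blocks, so the selective inequality bounds the inner sum by C'
    |sum_n a^k x_n|. *)
Lemma Fl1_base3_bound m As (a : eta -> 'I_m -> rmultiplier A) (S : eta -> dual A) M :
    Fl1_base3 As a -> 0 <= M -> (forall i, opnorm_le (S i) M) ->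
  exists2 C, 0 <= C & forall w : ('I_m -> A) * K^o,
    lspan (\bigcup_i multiplier_graph a S i @` As i) w -> `|w.2| <= C * \sum_k `|w.1 k|.
Proof.
move=> h M0 SM; have [C C0 aC] := Fl1_base3_lower h.
have [_ [_ _ _ [C' C'0 sel]] _] := h.
exists (M * C * C') => [|w]; first by rewrite !mulr_ge0// ltW.
move=> /lspan_bigcup[p [alpha [y [alphaI _ Ey ->]]]].
have [X hX] : exists X : 'I_p -> A, forall n,
    lspan (As (alpha n)) (X n) /\ multiplier_graph a S (alpha n) (X n) = y n.
  apply: (@ex_choice _ _ (fun n x =>
    lspan (As (alpha n)) x /\ multiplier_graph a S (alpha n) x = y n)) => n.
  have := Ey n; rewrite lspan_image; last exact: multiplier_graph_linear.
  by case=> x; exists x.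
have -> : (\sum_n y n).2 = \sum_n S (alpha n) (X n).
  rewrite (linear_sum_of (f := snd))//.
  by apply: eq_bigr => n _; rewrite -(hX n).2.
have y1 k : (\sum_n y n).1 k = \sum_n a (alpha n) k (X n).
  rewrite (linear_sum_of (f := fst))// fct_sumE.
  by apply: eq_bigr => n _; rewrite -(hX n).2.
apply: le_trans (ler_norm_sum _ _ _) _.
apply: (@le_trans _ _ (\sum_n M * (C * \sum_k `|a (alpha n) k (X n)|))).
  apply: ler_sum => n _; apply: le_trans ((SM _).2 _) _.
  by rewrite ler_wpM2l// aC//; exact: (hX n).1.
rewrite -mulr_sumr -mulr_sumr -!mulrA; apply: ler_wpM2l => //.
apply: ler_wpM2l; first exact: ltW.
rewrite exchange_big /= mulr_sumr.
apply: ler_sum => k _; rewrite y1.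
apply: (sel _ alpha (fun n => a (alpha n) k (X n))) => // n.
apply: (lspan_mono (E := a (alpha n) k @` As (alpha n))); first by exists k.
rewrite lspan_image; last exact: rmult_linear.
by exists (X n) => //; exact: (hX n).1.
Qed.

(** Without a lower bound on x a_alpha, the coefficients are used: |sum_n z_n S x_n| <= M B sum_n
    |z_n| <= M B C |sum_n z_n a x_n|. This requires combinations indexed by pairs (alpha, x) with
    distinct images. *)
Lemma Fl1_base1_bound As (a : eta -> rmultiplier A) (S : eta -> dual A) M :
    Fl1_base1 As a -> 0 <= M -> (forall i, opnorm_le (S i) M) ->
  exists2 C, 0 <= C & forall w : ('I_1 -> A) * K^o,
    lspan (\bigcup_i multiplier_graph (fun i _ => a i) S i @` As i) w ->
    `|w.2| <= C * \sum_k `|w.1 k|.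
Proof.
move=> [[_ /bounded_set_ex_gt0[B B0 AB] _ _ zero] [_ _ [C C0 l1]] aI] M0 SM.
pose L := \bigcup_i (a i @` As i).
have aL i x : As i x -> L (a i x) by move=> Ax; exists i => //; exists x.
(* The base inequality for the single vector 0 with coefficient 1 would read 1 <= 0. *)
have a0 i x : As i x -> a i x <> 0.
  move=> Ax ax; have := l1 1%N (fun=> 1) (fun=> a i x).
  rewrite !big_ord1 ax scaler0 normr0 mulr0 normr1.
  have /[swap]/[apply] : injective (fun _ : 'I_1 => 0 : A) by move=> ? ?; rewrite !ord1.
  have : forall n : 'I_1, (\bigcup_i [set a i x | x in As i]) 0.
    by move=> _; rewrite -ax; exact: aL.
  by move=> /[swap]/[apply]; rewrite ler10.
(* Within one alpha this is injectivity; across two, a common value would be a nonzero vector in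
   both spans. *)
have pairI i x j y : As i x -> As j y -> a i x = a j y -> (i, x) = (j, y).
  move=> Ax Ay axy; have [ij|/eqP ij] := eqVneq i j.
    by congr pair => //; subst j; apply: (aI i) => //; exact/mem_set.
  case: (a0 _ _ Ax); have : [set 0] (a i x); last by [].
  rewrite -(zero ord0 _ _ ij); split; apply: sub_lspan; first by exists x.
  by exists y.
exists (M * B * C) => [|w]; first by rewrite !mulr_ge0// ltW.
move=> Gw; pose E (ix : eta * A) := [set v | As ix.1 ix.2 /\
  v = multiplier_graph (fun i (_ : 'I_1) => a i) S ix.1 ix.2].
have {Gw}/lspan_bigcup[p [alpha [y [alphaI E0 Ey ->]]]] : lspan (\bigcup_ix E ix) w.
  by apply: (lspan_mono _ Gw) => _ [i _ [x Ax <-]]; exists (i, x).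
have Aalpha n : As (alpha n).1 (alpha n).2 by have [v []] := E0 n.
have [z hz] : exists z : 'I_p -> K, forall n,
    y n = z n *: multiplier_graph (fun i (_ : 'I_1) => a i) S (alpha n).1 (alpha n).2.
  apply: (@ex_choice _ _ (fun n c => y n = c *: _)) => n.
  by apply: lspan_set1; apply: (lspan_mono _ (Ey n)) => v [].
have -> : (\sum_n y n).2 = \sum_n z n *: S (alpha n).1 (alpha n).2.
  by rewrite (linear_sum_of (f := snd))//; apply: eq_bigr => n _; rewrite hz.
have -> : (\sum_n y n).1 = fun _ => \sum_n z n *: a (alpha n).1 (alpha n).2.
  rewrite (linear_sum_of (f := fst))// fct_sumE; apply/funext => k.
  by apply: eq_bigr => n _; rewrite hz.
rewrite big_ord1; apply: le_trans (ler_norm_sum _ _ _) _.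
apply: (@le_trans _ _ (\sum_n M * B * `|z n|)).
  apply: ler_sum => n _; rewrite normrM mulrC ler_wpM2r//.
  apply: le_trans ((SM _).2 _) _; rewrite ler_wpM2l//; apply: AB.
  by exists (alpha n).1.
rewrite -mulr_sumr -[leRHS]mulrA ler_wpM2l ?mulr_ge0 ?(ltW B0)//.
apply: l1 => [n n'|n]; last exact: aL.
move=> /(pairI _ _ _ _ (Aalpha n) (Aalpha n')) nn'; apply: alphaI.
by move: nn'; rewrite -!surjective_pairing.
Qed.

Lemma Fl1_base_interpolation (hK : real_or_complex K) m As
    (a : eta -> 'I_m -> rmultiplier A) (S : eta -> dual A) M :
    Fl1_base As a -> 0 <= M -> (forall i, opnorm_le (S i) M) ->
  exists T : 'I_m -> dual A, forall i x, As i x -> \sum_k T k (a i k x) = S i x.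
Proof.
move=> hbase M0 SM.
have [C C0 aC] : exists2 C, 0 <= C & forall w : ('I_m -> A) * K^o,
    lspan (\bigcup_i multiplier_graph a S i @` As i) w -> `|w.2| <= C * \sum_k `|w.1 k|.
  case: m a / hbase => [a h|a h|m a h].
  - exact: Fl1_base1_bound SM.
  - exact: Fl1_base3_bound (Fl1_base23 h) M0 SM.
  - exact: Fl1_base3_bound h M0 SM.
have [|T hT] := @dual_interpolation _ hK A m {ix : eta * A | As ix.1 ix.2}
  (fun ix k => a (sval ix).1 k (sval ix).2) (fun ix => S (sval ix).1 (sval ix).2) C C0.
  move=> w Gw; apply: aC; apply: (lspan_mono _ Gw) => _ [[[i x] /= Ax] _ <-].
  by exists i => //; exists x.
by exists T => i x Ax; exact: (hT (exist _ (i, x) Ax)).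
Qed.

End BaseInequalities.

(** * Factorization and cardinality *)

Section Factorization.
Context {K : numFieldType} (hK : real_or_complex K) {A : banachAlgType K}.
Context {dD : Order.disp_t} {D : preorderType dD} (e : D -> A).
Hypothesis he : bounded_approximate_identity e.
Context {d : Order.disp_t} {eta : orderType d}.
Hypothesis heta : initial_ordinal eta.
Hypothesis heta_inf : infinite_set [set: eta].

Lemma cofinal_ultrafilter_tail (p : set_system eta) i :
  cofinal_ultrafilter p -> p [set j | (i <= j)%O].
Proof.
move=> [pU pc]; have [//|pi] := in_ultra_setVsetC [set j | (i <= j)%O] pU.
by have [j /= nij] := pc _ pi i.
Qed.

Lemma lspan_bigcup_directed (As : eta -> set A) x :
    (forall i j, (i <= j)%O -> As i `<=` As j) ->
  lspan (\bigcup_i As i) x -> exists i, lspan (As i) x.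
Proof.
move=> AsM; have [i0 _] := infinite_setN0 heta_inf.
apply: (lspan_min (P := [set x | exists i, lspan (As i) x])).
- by move=> y [i _ Ay]; exists i; exact: sub_lspan.
- by exists i0; exact: (lspan_submod _).1.
- move=> c u v [i Au] [j Av]; exists (Order.max i j).
  apply: (lspan_submod _).2; [apply: lspan_mono Au|apply: lspan_mono Av];
    by apply: AsM; rewrite le_max lexx ?orbT.
Qed.

Lemma base_uniform_factorization m As (a : eta -> 'I_m -> rmultiplier A) :
  Fl1_base As a -> uniform_factorization (eta := eta) (cluster_set e a).
Proof.
move=> hbase; have [AsM _ clA [M aM] _] := Fl1_base_zooming hbase.
have [C hC] := cluster_point hK he aM.
have [lam [p hp]] := cofinal_ultrafilter_family heta heta_inf (card_lexx [set: eta]).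
(* [Psi] depends only on the base and the ultrafilters; it is fixed before [S] appears, which is the
   uniformity claimed. *)
have [Psi hPsi] := choice (fun lk : eta * 'I_m => hC (p lk.1) lk.2 (hp lk.1).1).
exists (fun l k => Psi (l, k)); split=> [l k||S [N SN]].
- by have [] := hPsi (l, k).
- by exists C => l k; have [] := hPsi (l, k).
have [i0 _] := infinite_setN0 heta_inf.
have [T hT] := Fl1_base_interpolation hK hbase (SN i0).1 (fun i => SN (lam i)).
exists T => l; have [pU _] := (hp l).1.
apply: (dual_eq_dense clA) => x [i _ Ax].
rewrite (linear_sum_of (f := fun F : dual A => F x))//.
(* Two limits of one function along [p l]: it is eventually constant, since [p l] contains the fibre
   of [l] and the tail on which [x] belongs to [As j]. *)
apply: (@norm_cvg_unique _ _ (fmap (fun j => \sum_k T k (a j k x)) (p l))).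
  apply: cvg_near_cst; apply: filterS2 (hp l).2 (cofinal_ultrafilter_tail i (hp l).1).
  by move=> j [_ <-] ij; apply: hT; exact: AsM Ax.
by apply: cvg_sum_ord => k; have [_ _] := hPsi (l, k); exact.
Qed.

(** If the elements at [l] and [l'] agreed, factoring the family equal to [S] at [l] and 0 elsewhere
    would give S = 0. *)
Lemma factorization_card (X : 'I_1 -> set (lucdual A)) k : (exists x : A, x <> 0) ->
  uniform_factorization (eta := eta) X -> ([set: eta] #<= X k)%card.
Proof.
move=> [x x0] [Psi [PsiX _ hPsi]]; have [S Sx] := dual_separates hK x0.
have [M SM] := dual_opnorm S.
apply: (@ex_card_le _ _ _ _ (fun l => Psi l k)) => [l _|l l' _ _ Psill'].
  exact: PsiX.
apply/eqP; apply: contrapT => /negP ll'; apply: Sx.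
have [|T hT] := hPsi (fun i => if i == l then S else 0).
  exists M => i; case: ifP => // _; split=> [|y]; first exact: SM.1.
  by rewrite /= normr0 mulr_ge0// SM.1.
have hl := hT l; rewrite eqxx big_ord1 in hl.
have hl' := hT l'; rewrite eq_sym (negPf ll') big_ord1 in hl'.
have k0 : ord0 = k by exact/esym/ord1.
have -> : S = 0 by rewrite hl k0 Psill' -k0 -hl'.
by [].
Qed.

(** Scalars are interpolated at the single vector [y], using coordinate [k] alone: value 1 on the
    fibre of [l], 0 on the others. The constant comes from sum |z_j| <= delta^-1 sum |z_j a_j y|
    followed by the selective inequality. *)
Lemma selective_card m As (a : eta -> 'I_m -> rmultiplier A) M k (B : set eta) i1
    y delta :
    (forall i k, opnorm_le (a i k) M) ->
    l1_selective_base (fun i => \bigcup_k (a i k @` As i)) ->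
    (forall i j, (i <= j)%O -> As i `<=` As j) ->
    ([set: eta] #<= B)%card -> lspan (As i1) y -> 0 < delta ->
    (forall i, B i -> (i1 <= i)%O /\ delta <= `|a i k y|) ->
  ([set: eta] #<= cluster_set e a k)%card.
Proof.
move=> aM [_ _ _ [C C0 sel]] AsM fB Ay delta0 hB.
have [C' hC] := cluster_point hK he aM.
have [lam [p hp]] := cofinal_ultrafilter_family heta heta_inf fB.
have [Psi hPsi] := choice (fun l => hC (p l) k (hp l).1).
apply: (@ex_card_le _ _ _ _ Psi) => [l _|l l' _ _ Psill']; first by have [] := hPsi l.
apply/eqP; apply: contrapT => /negP ll'.
pose s i : K^o := (lam i == l)%:R.
have [||T hT] := @dual_interpolation _ hK A 1 {i | B i}
    (fun i _ => a (sval i) k y) (fun i => s (sval i)) (delta^-1 * C).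
- by rewrite mulr_ge0 ?invr_ge0 ?ltW.
- move=> w Gw; pose E i := [set v : ('I_1 -> A) * K^o | B i /\ v = (fun=> a i k y, s i)].
  have {Gw}/lspan_bigcup[n [alpha [v [alphaI E0 Ev ->]]]] : lspan (\bigcup_i E i) w.
    by apply: (lspan_mono _ Gw) => _ [[i Bi] _ <-]; exists i.
  have Balpha j : B (alpha j) by have [? []] := E0 j.
  have [z hz] : exists z : 'I_n -> K, forall j,
      v j = z j *: ((fun=> a (alpha j) k y, s (alpha j)) : ('I_1 -> A) * K^o).
    apply: (@ex_choice _ _ (fun j c => v j = c *: _)) => j.
    by apply: lspan_set1; apply: (lspan_mono _ (Ev j)) => u [].
  have -> : (\sum_j v j).2 = \sum_j z j *: s (alpha j).
    by rewrite (linear_sum_of (f := snd))//; apply: eq_bigr => j _; rewrite hz.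
  have -> : (\sum_j v j).1 = fun _ => \sum_j z j *: a (alpha j) k y.
    rewrite (linear_sum_of (f := fst))// fct_sumE; apply/funext => k'.
    by apply: eq_bigr => j _; rewrite hz.
  rewrite big_ord1; apply: le_trans (ler_norm_sum _ _ _) _.
  apply: (@le_trans _ _ (\sum_j delta^-1 * `|z j *: a (alpha j) k y|)).
    apply: ler_sum => j _; rewrite ler_pdivlMl// normrM normrZ mulrCA.
    apply: ler_wpM2l => //; apply: le_trans (hB _ (Balpha j)).2.
    by rewrite ger_pMr// /s; case: eqP; rewrite ?normr1 ?normr0.
  rewrite -mulr_sumr -mulrA; apply: ler_wpM2l; first by rewrite invr_ge0 ltW.
  apply: (sel _ alpha) => // j; apply: lspanZ.
  apply: (lspan_mono (E := a (alpha j) k @` As (alpha j))); first by exists k.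
  rewrite lspan_image; last exact: rmult_linear.
  by exists y => //; apply: lspan_mono Ay; apply: AsM; exact: (hB _ (Balpha j)).1.
have act l1 : lucdual_act (Psi l1) (T ord0) y = (l1 == l)%:R.
  have [pU _] := (hp l1).1; have [_ _ cvT] := hPsi l1.
  apply: norm_cvg_unique (cvT _ _) _; apply: cvg_near_cst.
  apply: filterS (hp l1).2 => i [Bi <-].
  by have := hT (exist _ i Bi); rewrite big_ord1.
have := act l; rewrite Psill' act eqxx eq_sym (negPf ll') => /eqP.
by rewrite eq_sym oner_eq0.
Qed.

End Factorization.

Theorem theorem4p14 (K : numFieldType) (hK : real_or_complex K)
    (A : banachAlgType K) (hA : exists x : A, x <> 0)
    (dD : Order.disp_t) (D : preorderType dD) (e : D -> A)
    (he : bounded_approximate_identity e)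
    (deta : Order.disp_t) (eta : orderType deta)
    (heta : initial_ordinal eta) (heta_inf : infinite_set [set: eta])
    (m : nat) (hm : (0 < m)%N)
    (As : eta -> set A) (a : eta -> 'I_m -> rmultiplier A)
    (hbase : Fl1_base As a) :
  [/\ m = 1%N -> forall k, ([set: eta] #<= cluster_set e a k)%card,
      exists k, ([set: eta] #<= cluster_set e a k)%card,
      forall k, nondegenerate_coord a k -> ([set: eta] #<= cluster_set e a k)%card &
      uniform_factorization (eta := eta) (cluster_set e a)].
Proof.
have fact := base_uniform_factorization hK he heta heta_inf hbase.
have card1 : m = 1%N -> forall k, ([set: eta] #<= cluster_set e a k)%card.
  move=> m1; subst m => k; exact: factorization_card fact.
have [m1|h] : m = 1%N \/ Fl1_base3 As a.
  by case: hbase => *; [left|left|right].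
  by split=> // [|k _]; [exists (Ordinal hm)|]; exact: card1.
have [[AsM _ clA [M aM] _] sel _] := h.
have [C C0 aC] := Fl1_base3_lower h.
have [i0 _] := infinite_setN0 heta_inf.
have M0 : 0 <= M := (aM i0 (Ordinal hm)).1.
split=> // [|k [x [i1 [delta delta0 ax]]]].
- have [x x0] := hA.
  have nx0 : 0 < `|x| by rewrite normr_gt0; apply/eqP.
  have [y Ay xy] := closure_dist x clA nx0.
  have y0 : 0 < `|y|.
    by rewrite normr_gt0; apply: contraTneq xy => ->; rewrite subr0 ltxx.
  have [i1 Ay1] := lspan_bigcup_directed heta_inf AsM Ay.
  (* If all m coordinates were below [delta], then |y| <= C m delta < C (m + 1) delta = |y|; the
     successor makes the inequality strict. *)
  pose delta := `|y| / (C * m.+1%:R).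
  have delta0 : 0 < delta by rewrite divr_gt0// mulr_gt0// ltr0n.
  (* The large coordinate may vary with the index; one [k] works on a set of full cardinality, not
     necessarily on a tail. *)
  have [|k _ fk] := full_pigeonhole heta heta_inf (s := enum 'I_m)
      (P := fun k => [set i | (i1 <= i)%O /\ delta <= `|a i k y|])
      (full_tail heta heta_inf i1).
    move=> i i1i; apply: contrapT => nk.
    have small k : `|a i k y| < delta.
      rewrite real_ltNge ?normr_real ?gtr0_real//; apply/negP => dk.
      by apply: nk; exists k; rewrite ?mem_enum.
    have := aC i y (lspan_mono (AsM _ _ i1i) Ay1).
    apply/negP; rewrite -real_ltNge ?normr_real//; last first.
      by rewrite ger0_real// mulr_ge0 ?sumr_ge0// ltW.
    apply: (@le_lt_trans _ _ (C * (delta *+ m))).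
      have -> : delta *+ m = \sum_(k < m) delta by rewrite sumr_const card_ord.
      apply: ler_wpM2l; first exact: ltW.
      by apply: ler_sum => k _; exact: ltW.
    have -> : `|y| = C * (delta *+ m.+1).
      rewrite -mulr_natr mulrCA divfK// mulf_eq0 pnatr_eq0 orbF.
      by rewrite gt_eqF.
    by rewrite ltr_pM2l// mulrS ltrDr.
  by exists k; apply: (selective_card hK he heta heta_inf aM sel AsM fk Ay1 delta0).
(* The vector [x] need not lie in the span of any [As i]. Replacing it by a nearby [y] that does
   moves its images by at most delta / 2, since M / (M + 1) <= 1, and leaves the lower bound delta /
   2. *)
have M1 : 0 < 2 * (M + 1) by rewrite mulr_gt0// ltr_wpDl.
have [y Ay xy] := closure_dist x clA (divr_gt0 delta0 M1).
have [i2 Ay2] := lspan_bigcup_directed heta_inf AsM Ay.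
apply: (selective_card hK he heta heta_inf aM sel AsM
  (full_tail heta heta_inf (Order.max i1 i2)) Ay2 (delta := delta / 2)).
  by rewrite divr_gt0.
move=> i; rewrite /= ge_max => /andP[i1i i2i]; split=> //.
have axy : `|a i k (x - y)| <= delta / 2.
  rewrite (le_trans ((aM i k).2 _))// (le_trans (ler_wpM2l M0 (ltW xy)))//.
  have -> : M * (delta / (2 * (M + 1))) = delta / 2 * (M / (M + 1)).
    by rewrite invfM mulrCA -!mulrA; congr (_ * _); rewrite mulrCA.
  rewrite ger_pMr ?divr_gt0// ler_pdivrMr ?ltr_wpDl// mul1r.
  by rewrite lerDl.
rewrite -(lerD2r (delta / 2)) -splitr (le_trans (ax _ i1i))//.
rewrite -[x in leLHS](subrK y) raddfD /= addrC (le_trans (ler_normD _ _))//.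
by rewrite lerD.
Qed.
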